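(* For every fixed real $\delta$ with $0<\delta<(1/36)^8$ there exists an integer $n_0$ such that the following holds for all integers $n\ge n_0$. If $H=(V,E)$ is a Fano-plane-free $3$-uniform hypergraph on $n$ vertices with at least $\mathrm{ex}(n,\mathbb{F})-\delta n^3/8$ hyperedges, then there is a partition $V=A\cup B$ such that $$e_H(A)+e_H(B)\le \frac{9}{16}\,(3^2\cdot 2^4\cdot 139)^{1/8}\,\delta^{1/64}\, n^3<1.94\,\delta^{1/64}n^3 .$$
   Context: A $3$-uniform hypergraph $H=(V,E)$ has $E\subseteq\binom{V}{3}$. The Fano plane $\mathbb{F}$ is the unique linear $3$-uniform hypergraph with $7$ vertices and $7$ hyperedges (linear: any two distinct hyperedges share at most one vertex), i.e. the projective plane over the field with two elements. $H$ is $\mathbb{F}$-free if it contains no copy of $\mathbb{F}$ as a subhypergraph. $\mathrm{ex}(n,\mathbb{F})$ is the maximum number of hyperedges in an $\mathbb{F}$-free $3$-uniform hypergraph on $n$ vertices. For $X\subseteq V$, $e_H(X)$ denotes the number of hyperedges $e\in E$ with $e\subseteq X$. *)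

(* Defs.v *)
From mathcomp Require Import all_boot all_order all_algebra.
From mathcomp Require Import reals exp.

Set Implicit Arguments.
Unset Strict Implicit.
Unset Printing Implicit Defensive.

Import Order.TTheory GRing.Theory Num.Theory.

Local Open Scope ring_scope.

(* A hypergraph on the vertex type T is given by its hyperedges
   E : {set {set T}}; its vertex set is all of T. *)

Definition uniform_hypergraph (k : nat) (T : finType) (E : {set {set T}}) :=
  [forall e in E, #|e| == k].

Definition linear_hypergraph (T : finType) (E : {set {set T}}) :=
  [forall e1 in E, forall e2 in E, (e1 != e2) ==> (#|e1 :&: e2| <= 1)%N].

(* Not necessarily induced copies: E may have further hyperedges inside the
   image of f. *)
Definition contains_copy (U T : finType) (F : {set {set U}})
    (E : {set {set T}}) :=
  [exists f : {ffun U -> T}, injectiveb f && [forall e in F, f @: e \in E]].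

(* The addition is that of 'I_7, i.e. modulo 7: {0, 1, 3} is a perfect
   difference set, and its translates are the lines of the projective plane
   of order 2. *)
Definition fano_line (i : 'I_7) : {set 'I_7} := [set i; i + 1; i + 3%:R].

Definition fano : {set {set 'I_7}} := [set fano_line i | i : 'I_7].

Lemma card_fano_lineI (i j : 'I_7) :
  #|fano_line i :&: fano_line j| = if i == j then 3 else 1%N.
Proof.
rewrite -sum1_card big_mkcond /= !big_ord_recl big_ord0 !inE.
by case: i => [[|[|[|[|[|[|[|]]]]]]] // ?];
   case: j => [[|[|[|[|[|[|[|]]]]]]] // ?].
Qed.

Lemma fano_uniform : uniform_hypergraph 3 fano.
Proof.
apply/forall_inP => _ /imsetP[i _ ->].
by rewrite -(setIid (fano_line i)) card_fano_lineI eqxx.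
Qed.

Lemma fano_linear : linear_hypergraph fano.
Proof.
apply/forall_inP => _ /imsetP[i _ ->]; apply/forall_inP => _ /imsetP[j _ ->].
by apply/implyP; rewrite card_fano_lineI; case: (eqVneq i j) => [->|//]; rewrite eqxx.
Qed.

Lemma card_fano : #|fano| = 7.
Proof.
rewrite card_imset ?card_ord // => i j ij; apply/eqP.
have := card_fano_lineI i j; rewrite ij setIid.
by rewrite -{1}(setIid (fano_line j)) card_fano_lineI eqxx; case: (i == j).
Qed.

Definition fano_free (T : finType) (E : {set {set T}}) :=
  ~~ contains_copy fano E.

Definition ex_fano (n : nat) : nat :=
  \max_(E : {set {set 'I_n}} | uniform_hypergraph 3 E && fano_free E) #|E|.

Definition edges_inside (T : finType) (E : {set {set T}}) (X : {set T}) : nat :=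
  #|[set e in E | e \subset X]|.

(* Main.v *)
(* Let r = delta^(1/64) and s = r^32, and count ordered tuples throughout.
   The links of the four vertices of a K_4^(3) form a multigraph whose edges
   carry sets of at most four colours. Three colours on the three perfect
   matchings of a quadruple would complete a Fano plane, so this multigraph has
   at most about 3/2 n^2 edges. As a dense hypergraph contains a K_4^(3), this
   also gives at most about n^3/8 hyperedges. Maximising
   #(ordered triples in X) - (3/4 - s) |X|^3 over X therefore gives a set of
   almost all vertices with large minimum degree, hence a K_4^(3) whose coloured
   multigraph misses only O(s n^2) of its maximal weight. A similar
   maximisation yields a large set Z on which all weighted degrees are at least
   2.99 |Z|. There the pairs of weight at least 3 form a bipartite graph, so Z
   splits into parts A and B with weight at most 2 inside each part and, up to
   O(s n^2), weight exactly 2 inside and 4 across. Nearly all pairs inside A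
   then carry the same two colours, so some vertex c is joined to all but
   O(s n^2) of the pairs in A. An octahedron in A whose three diagonals lie in
   the link of c completes a Fano plane. Since density d forces octahedron
   density d^8, A spans at most O(s^(1/8) n^3) hyperedges, and so does B. *)

Require Import Defs.
From mathcomp Require Import all_boot all_order all_algebra.
From mathcomp Require Import reals exp.
From mathcomp Require Import zify ring lra.

Set Implicit Arguments.
Unset Strict Implicit.
Unset Printing Implicit Defensive.

Import Order.TTheory GRing.Theory Num.Theory.

Local Open Scope nat_scope.

(** * Fano configurations *)

Lemma sdr3 (T : finType) (A B C : {set T}) :
  0 < #|A| -> 1 < #|B| -> 2 < #|C| ->
  exists i j k, [/\ i \in A, j \in B, k \in C & [&& i != j, i != k & j != k]].
Proof.
move=> /card_gt0P[i iA] B1 C2.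
have /card_gt0P[j] : 0 < #|B :\ i| by have := cardsD1 i B; lia.
rewrite !inE => /andP[ji jB].
have /card_gt0P[k] : 0 < #|C :\ i :\ j|.
  by have := cardsD1 i C; have := cardsD1 j (C :\ i); lia.
rewrite !inE => /and3P[kj ki kC].
by exists i, j, k; split=> //; rewrite eq_sym ji eq_sym ki eq_sym.
Qed.

(** Hall's condition holds: two distinct sets with at least two elements each have a union of size
    at least 3. The proof fixes [k] and [i] first; it can only get stuck if both [A] and [B] equal
    [[set k; i]]. *)
Lemma sdr3_neq (T : finType) (A B C : {set T}) :
  1 < #|A| -> 1 < #|B| -> 0 < #|C| -> A != B ->
  exists i j k, [/\ i \in A, j \in B, k \in C & [&& i != j, i != k & j != k]].
Proof.
move=> A1 B1 /card_gt0P[k kC] nAB.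
have /card_gt0P[i] : 0 < #|A :\ k| by have := cardsD1 k A; lia.
rewrite !inE => /andP[ik iA].
have [/eqP|] := posnP #|B :\ k :\ i|; last first.
  move=> /card_gt0P[j]; rewrite !inE => /and3P[ji jk jB].
  by exists i, j, k; split=> //; rewrite eq_sym ji ik jk.
rewrite cards_eq0 => /eqP B0.
have /card_gt0P[j] : 0 < #|B :\ k| by have := cardsD1 k B; lia.
rewrite !inE => /andP[jk jB].
have ji : j = i.
  by apply/eqP/negPn/negP => nji; have := in_set0 j; rewrite -B0 !inE nji jk jB.
have [/eqP|] := posnP #|A :\ k :\ i|; last first.
  move=> /card_gt0P[l]; rewrite !inE => /and3P[li lk lA].
  by exists l, j, k; split=> //; rewrite ji li lk ik.
rewrite cards_eq0 => /eqP A0.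
have pair (D : {set T}) : 1 < #|D| -> D :\ k :\ i = set0 -> D = [set k; i].
  move=> D1 D0; apply/eqP; rewrite eqEcard cards2 eq_sym ik D1 andbT.
  apply/subsetP => l lD; have := in_set0 l; rewrite -D0 !inE lD.
  by do 2!case: (l == _).
by case/eqP: nAB; rewrite (pair _ A1 A0) (pair _ B1 B0).
Qed.

Section Edge3.
Variables (T : finType) (E : {set {set T}}).

Definition edge3 (x y z : T) : bool := [set x; y; z] \in E.

Lemma edge3C x y z : edge3 x y z = edge3 y x z.
Proof. by rewrite /edge3 (setUC [set x]). Qed.

Lemma edge3CA x y z : edge3 x y z = edge3 x z y.
Proof. by rewrite /edge3 -!setUA (setUC [set y]). Qed.

Hypothesis unifE : uniform_hypergraph 3 E.

Lemma edge3_neq x y z : edge3 x y z -> [&& x != y, x != z & y != z].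
Proof.
move=> /(forall_inP unifE)/eqP c3; apply/and3P; split; apply/eqP => exy; move: c3.
- by rewrite exy setUid cards2; case: eqP.
- by rewrite exy setUAC setUid cards2; case: eqP.
- by rewrite exy -setUA setUid cards2; case: eqP.
Qed.

Lemma edge3xx x y : edge3 x x y = false.
Proof. by apply/negP => /edge3_neq; rewrite eqxx. Qed.

Lemma edge3_neqr x y z : edge3 x y z -> y != z.
Proof. by case/edge3_neq/and3P. Qed.

Hypothesis freeE : fano_free E.

(* Any two of the seven points lie on a line, so they are distinct as soon as
   all the lines are hyperedges. *)
Lemma fano_config a0 a1 a2 a3 a4 a5 a6 :
  edge3 a0 a1 a3 -> edge3 a1 a2 a4 -> edge3 a2 a3 a5 -> edge3 a3 a4 a6 ->
  edge3 a4 a5 a0 -> edge3 a5 a6 a1 -> edge3 a6 a0 a2 -> False.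
Proof.
move=> h0 h1 h2 h3 h4 h5 h6; case/negP: freeE.
pose s := [tuple a0; a1; a2; a3; a4; a5; a6].
apply/existsP; exists [ffun i => tnth s i]; apply/andP; split.
  apply/injectiveP/(eq_inj (f := tnth s)); last by move=> i; rewrite ffunE.
  apply/tuple_uniqP; rewrite /= !inE !negb_or.
  move: (edge3_neq h0) (edge3_neq h1) (edge3_neq h2) (edge3_neq h3).
  move: (edge3_neq h4) (edge3_neq h5) (edge3_neq h6).
  rewrite ![a4 == _]eq_sym ![a5 == _]eq_sym ![a6 == _]eq_sym.
  rewrite (eq_sym a4 a5) (eq_sym a4 a6) (eq_sym a5 a6).
  by do 7!move=> /and3P[-> -> ->].
apply/forall_inP => _ /imsetP[i _ ->].
rewrite /fano_line !imsetU !imset_set1 !ffunE.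
have e (j : 'I_7) (m : nat) (x : T) : j = m :> nat -> nth a0 s m = x -> tnth s j = x.
  by move=> jm <-; rewrite (tnth_nth a0) jm.
case: i => [[|[|[|[|[|[|[|//]]]]]]] lti];
  rewrite -/(edge3 _ _ _).
- by rewrite (e _ 0 a0)// (e _ 1 a1)// (e _ 3 a3).
- by rewrite (e _ 1 a1)// (e _ 2 a2)// (e _ 4 a4).
- by rewrite (e _ 2 a2)// (e _ 3 a3)// (e _ 5 a5).
- by rewrite (e _ 3 a3)// (e _ 4 a4)// (e _ 6 a6).
- by rewrite (e _ 4 a4)// (e _ 5 a5)// (e _ 0 a0).
- by rewrite (e _ 5 a5)// (e _ 6 a6)// (e _ 1 a1).
- by rewrite (e _ 6 a6)// (e _ 0 a0)// (e _ 2 a2).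
Qed.

End Edge3.

(** * The coloured links of a K_4^(3) *)

Section Links.
Variables (T : finType) (E : {set {set T}}).

Definition clique4 (S : {set T}) :=
  #|S| = 4 /\ forall i j k, i \in S -> j \in S -> k \in S ->
    [&& i != j, i != k & j != k] -> edge3 E i j k.

Variable S : {set T}.

Definition colours (x y : T) : {set T} := [set i in S | edge3 E i x y].

Definition weight (x y : T) : nat := #|colours x y|.

Lemma coloursC x y : colours x y = colours y x.
Proof. by apply/setP => i; rewrite !inE edge3CA. Qed.

Lemma weightC x y : weight x y = weight y x.
Proof. by rewrite /weight coloursC. Qed.

Hypotheses (unifE : uniform_hypergraph 3 E) (freeE : fano_free E).
Hypothesis cliqueS : clique4 S.

Lemma weightxx x : weight x x = 0.
Proof.
apply: eq_card0 => i; rewrite !inE.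
by apply/negP => /andP[_ /(edge3_neq unifE)]; rewrite eqxx !andbF.
Qed.

Lemma weight_le4 x y : weight x y <= 4.
Proof. by rewrite -cliqueS.1 subset_leq_card// /colours setIdE subsetIl. Qed.

Lemma weight_colI x y x' y' :
  weight x y + weight x' y' <= #|colours x y :&: colours x' y'| + 4.
Proof.
rewrite /weight -cardsUI addnC leq_add2l -cliqueS.1 subset_leq_card//.
by apply/subsetP => i; rewrite !inE => /orP[] /andP[].
Qed.

(* The three perfect matchings of a quadruple cannot receive three distinct
   colours: together with the hyperedge on these colours they would form a
   Fano plane.  Coincidences among u, v, x, y need not be excluded. *)
Lemma rainbow_free u v x y i j k :
  i \in colours u v :&: colours x y -> j \in colours u x :&: colours v y ->
  k \in colours u y :&: colours v x -> [&& i != j, i != k & j != k] -> False.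
Proof.
rewrite !inE => /andP[/andP[iS iuv] /andP[_ ixy]].
move=> /andP[/andP[jS jux] /andP[_ jvy]] /andP[/andP[kS kuy] /andP[_ kvx]] neq.
apply: (@fano_config _ _ unifE freeE i j u k x y v).
- exact: cliqueS.2.
- by [].
- by rewrite edge3C.
- by rewrite edge3CA.
- by rewrite edge3CA edge3C.
- by rewrite edge3CA edge3C edge3CA.
- by rewrite edge3C edge3CA.
Qed.

(** [a], [b], [c] count the colours common to both pairs of a perfect matching. Sizes 1, 2, 3 in any
    order would allow a greedy choice of distinct colours; the six disjuncts are the six orders. *)
Lemma quad_sdr u v x y :
  let a := #|colours u v :&: colours x y| in
  let b := #|colours u x :&: colours v y| in
  let c := #|colours u y :&: colours v x| in
  ~~ [|| [&& 0 < a, 1 < b & 2 < c], [&& 0 < a, 1 < c & 2 < b],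
         [&& 0 < b, 1 < a & 2 < c], [&& 0 < b, 1 < c & 2 < a],
         [&& 0 < c, 1 < a & 2 < b] | [&& 0 < c, 1 < b & 2 < a]].
Proof.
cbv zeta; apply/negP.
do ![case/orP] => /and3P[p q r]; have [i [j [k []]]] := sdr3 p q r;
  move=> iM jM kM /and3P[ij ik jk].
- by apply: (rainbow_free iM jM kM); rewrite ij ik jk.
- by apply: (rainbow_free iM kM jM); rewrite ij ik eq_sym jk.
- by apply: (rainbow_free jM iM kM); rewrite jk ik eq_sym ij.
- by apply: (rainbow_free kM iM jM); rewrite ij (eq_sym k) ik (eq_sym k) jk.
- by apply: (rainbow_free jM kM iM); rewrite jk (eq_sym j) ij (eq_sym k) ik.
- by apply: (rainbow_free kM jM iM); rewrite !(eq_sym k) jk ik (eq_sym j) ij.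
Qed.

(** Two subsets of the four colours share at least the sum of their sizes minus 4. The constraint on
    a quadruple thus becomes linear arithmetic in its six weights. *)
Lemma quad_weights u v x y : exists a b c,
  [/\ weight u v + weight x y <= a + 4, weight u x + weight v y <= b + 4,
      weight u y + weight v x <= c + 4 &
  ~~ [|| [&& 0 < a, 1 < b & 2 < c], [&& 0 < a, 1 < c & 2 < b],
         [&& 0 < b, 1 < a & 2 < c], [&& 0 < b, 1 < c & 2 < a],
         [&& 0 < c, 1 < a & 2 < b] | [&& 0 < c, 1 < b & 2 < a]]].
Proof.
by do 3!eexists; split; [exact: weight_colI..|exact: quad_sdr].
Qed.

(** The three matchings have at least [weight x y - 1], [weight v y] and [weight u y] common
    colours, and a total of 10 always makes these at least 1, 2, 3 in some order. *)
Lemma triangle_sum u v x y : 3 <= weight u v -> weight u x = 4 -> weight v x = 4 ->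
  weight u y + weight v y + weight x y <= 9.
Proof.
move=> uv ux vx; have [a [b [c []]]] := quad_weights u v x y.
by move: (weight_le4 u v); move: (weight_le4 u y); move: (weight_le4 v y);
  move: (weight_le4 x y); lia.
Qed.

Lemma triangle_tight u v x y : 3 <= weight u v -> weight u x = 4 -> weight v x = 4 ->
  9 <= weight u y + weight v y + weight x y -> weight u y = 4 /\ weight v y = 4.
Proof.
move=> uv ux vx; have [a [b [c []]]] := quad_weights u v x y.
by move: (weight_le4 u v); move: (weight_le4 u y); move: (weight_le4 v y);
  move: (weight_le4 x y); lia.
Qed.

Lemma four_cycle_weight u v y y' : 3 <= weight u v ->
  weight u y = 4 -> weight v y = 4 -> weight u y' = 4 -> weight v y' = 4 ->
  weight y y' <= 1.
Proof.
move=> uv uy vy uy' vy'; have [a [b [c []]]] := quad_weights u v y y'.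
by move: (weight_le4 u v); move: (weight_le4 y y'); lia.
Qed.

Lemma triangle433_weight u v x y : weight u v = 4 ->
  weight u x = 3 -> weight v x = 3 -> weight u y + weight v y = 6 ->
  weight x y <= 2.
Proof.
move=> uv ux vx uvy; have [a [b [c []]]] := quad_weights u v x y.
by move: (weight_le4 u y); move: (weight_le4 v y); move: (weight_le4 x y); lia.
Qed.

(** Since [t] is joined to [u], [x], [x'] in all colours, the three matchings of the quadruple carry
    exactly the colour sets of the triangle [u], [x], [x']. If two of these differed, [sdr3_neq]
    would give a rainbow. *)
Lemma inner_triangle_colours t u x x' :
  weight t u = 4 -> weight t x = 4 -> weight t x' = 4 ->
  1 < weight u x -> 1 < weight u x' -> 1 < weight x x' ->
  colours u x = colours x x'.
Proof.
move=> tu tx tx' ux ux' xx'; apply/eqP; apply/negPn/negP => neq.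
have full y z : weight t y = 4 -> colours t y :&: z = S :&: z.
  move=> ty; congr (_ :&: _); apply/eqP.
  rewrite eqEcard cliqueS.1 -/(weight t y) ty leqnn andbT.
  by rewrite /colours setIdE subsetIl.
have inS y z : S :&: colours y z = colours y z.
  by apply/setIidPr; rewrite /colours setIdE subsetIl.
have [i [j [k [iM jM kM /and3P[ij ik jk]]]]] := sdr3_neq ux xx' (ltnW ux') neq.
apply: (@rainbow_free t u x x' j k i); rewrite ?full ?inS //.
by rewrite jk (eq_sym j) ij (eq_sym k) ik.
Qed.

End Links.

(** * Weighted degrees and total weight of the coloured multigraph *)

Lemma sum_pred (T : finType) (X : {set T}) (P : pred T) :
  \sum_(y in X) (P y : nat) = #|[set y in X | P y]|.
Proof.
rewrite -sum1_card [RHS](eq_bigl (fun y => (y \in X) && P y)); last by move=> y; rewrite !inE.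
by rewrite [RHS]big_mkcondr; apply: eq_bigr => y _; case: (P y).
Qed.

Lemma sum_le_const (T : finType) (X : {set T}) (F : T -> nat) c :
  (forall x, x \in X -> F x <= c) -> \sum_(x in X) F x <= c * #|X|.
Proof. by move=> Fc; rewrite mulnC -sum_nat_const; apply: leq_sum. Qed.

Section WeightSums.
Variables (T : finType) (E : {set {set T}}) (S : {set T}).
Local Notation weight := (weight E S).

Definition wdeg (X : {set T}) x := \sum_(y in X) weight x y.
(** Over ordered pairs, so each pair counts twice and the extremal value is about [3 * #|X| ^ 2]. *)
Definition wsum (X : {set T}) := \sum_(x in X) wdeg X x.

Definition dense (X : {set T}) :=
  forall x, x \in X -> 299 * #|X| <= 100 * wdeg X x.

Hypothesis unifE : uniform_hypergraph 3 E.

Lemma wsumD1 (X : {set T}) x : x \in X -> wsum X = wsum (X :\ x) + 2 * wdeg X x.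
Proof.
move=> xX; rewrite /wsum (big_setD1 x xX) /=.
have -> : \sum_(y in X :\ x) wdeg X y =
    \sum_(y in X :\ x) weight y x + \sum_(y in X :\ x) wdeg (X :\ x) y.
  by rewrite -big_split; apply: eq_bigr => y _; rewrite /wdeg (big_setD1 x xX).
have -> : \sum_(y in X :\ x) weight y x = wdeg X x.
  rewrite /wdeg [RHS](big_setD1 x xX) weightxx //=.
  by apply: eq_bigr => y _; rewrite weightC.
lia.
Qed.

Hypothesis freeE : fano_free E.
Hypothesis cliqueS : clique4 E S.

Let weight4 x y : weight x y <= 4 := weight_le4 cliqueS x y.

(** By [triangle_sum] every vertex sends at most 9 to the triangle, so density makes at least 97% of
    them attain 9. Those are joined to [u] and [v] with weight 4, hence to each other with weight at
    most 1, and any one of them has too small a degree. *)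
Lemma dense_no443 (X : {set T}) u v x : dense X -> u \in X -> v \in X -> x \in X ->
  3 <= weight u v -> weight u x = 4 -> weight v x = 4 -> False.
Proof.
move=> dX uX vX xX uv ux vx.
pose P y := 9 <= weight u y + weight v y + weight x y.
have m0 : 0 < #|X| by apply/card_gt0P; exists u.
have sum_f : wdeg X u + wdeg X v + wdeg X x <= 8 * #|X| + #|[set y in X | P y]|.
  rewrite /wdeg -!big_split /= -sum_pred mulnC -sum_nat_const -big_split /=.
  apply: leq_sum => y _.
  by move: (triangle_sum unifE freeE cliqueS y uv ux vx); rewrite /P; lia.
have /card_gt0P[y] : 0 < #|[set y in X | P y]|.
  by move: (dX _ uX) (dX _ vX) (dX _ xX); lia.
rewrite inE => /andP[yX Py].
have [uy vy] := triangle_tight unifE freeE cliqueS uv ux vx Py.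
have : wdeg X y + 3 * #|[set y in X | P y]| <= 4 * #|X|.
  rewrite /wdeg -sum_pred big_distrr -big_split /=.
  apply: sum_le_const => y' _.
  have [/(triangle_tight unifE freeE cliqueS uv ux vx)[uy' vy']|_] := boolP (P y').
    by have := four_cycle_weight unifE freeE cliqueS uv uy vy uy' vy'; lia.
  by have := weight4 y y'; lia.
by move: (dX _ uX) (dX _ vX) (dX _ xX) (dX _ yX); lia.
Qed.

Lemma dense_edge4_sum (X : {set T}) u v y : dense X -> u \in X -> v \in X -> y \in X ->
  weight u v = 4 -> weight u y + weight v y <= 6.
Proof.
move=> dX uX vX yX uv; rewrite leqNgt; apply/negP => uvy.
have := weight4 u y; have := weight4 v y => vy4 uy4.
have [uy|uy] := leqP 4 (weight u y).
  by apply: (dense_no443 (u := v) (v := y) (x := u) dX) => //;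
    rewrite ?(weightC E S v u) ?(weightC E S y u); lia.
by apply: (dense_no443 (u := u) (v := y) (x := v) dX) => //; rewrite ?(weightC E S y v); lia.
Qed.

(** Deleting a vertex from a minimal counterexample shows that all its degrees exceed [3 * #|X|]. A
    pair of weight 4 contradicts this through [dense_edge4_sum], and without such a pair all weights
    are at most 3. *)
Lemma wsum_le (X : {set T}) : wsum X <= 3 * #|X| ^ 2 + 3 * #|X|.
Proof.
have [m] := ubnP #|X|; elim: m X => // m IHm X Xm; rewrite leqNgt; apply/negP => big.
have [X0|/card_gt0P[x0 x0X]] := posnP #|X|.
  by move: big; rewrite /wsum (cards0_eq X0) big_set0.
have deg x : x \in X -> 3 * #|X| < wdeg X x.
  move=> xX; have cX := cardsD1 x X; rewrite xX in cX.
  have /IHm : #|X :\ x| < m by lia.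
  by move: big; rewrite (wsumD1 xX) cX; nia.
have dX : dense X by move=> x /deg; lia.
have [/existsP[u /existsP[v /and3P[uX vX /eqP uv]]]|no4] :=
  boolP [exists u, exists v, [&& u \in X, v \in X & weight u v == 4]].
  have : wdeg X u + wdeg X v <= 6 * #|X|.
    rewrite /wdeg -big_split; apply: sum_le_const => y yX.
    exact: (dense_edge4_sum dX uX vX).
  by move: (deg _ uX) (deg _ vX); lia.
have : wdeg X x0 <= 3 * #|X|.
  apply: sum_le_const => y yX; move/existsPn/(_ x0)/existsPn/(_ y): no4.
  by rewrite x0X yX /=; have := weight4 x0 y; lia.
by have := deg _ x0X; lia.
Qed.

End WeightSums.

(** * Structure of dense coloured multigraphs *)

Section DenseStructure.
Variables (T : finType) (E : {set {set T}}) (S : {set T}).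
Hypotheses (unifE : uniform_hypergraph 3 E) (freeE : fano_free E).
Hypothesis cliqueS : clique4 E S.

Local Notation weight := (weight E S).
Local Notation colours := (colours E S).
Local Notation wdeg := (wdeg E S).

Variable X : {set T}.
Hypothesis dX : dense E S X.

Let weight4 x y : weight x y <= 4 := weight_le4 cliqueS x y.
Let no443 u v x := @dense_no443 _ _ _ unifE freeE cliqueS X u v x dX.

Definition light u v := [set y in X | weight u y + weight v y <= 5].

Lemma card_light u v : u \in X -> v \in X -> weight u v = 4 ->
  100 * #|light u v| <= 2 * #|X|.
Proof.
move=> uX vX uv.
have : wdeg X u + wdeg X v + #|light u v| <= 6 * #|X|.
  rewrite /light -sum_pred -!big_split /=; apply: sum_le_const => y yX.
  by have := dense_edge4_sum unifE freeE cliqueS dX uX vX yX uv; lia.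
by have := (dX uX); have := dX vX; lia.
Qed.

(** Outside the at most 2% of light vertices, [u] and [v] together send exactly 6 to [y], which
    forces [weight x y <= 2]; so [x] has degree at most about [2.04 * #|X|]. *)
Lemma dense_no433 u v x : u \in X -> v \in X -> x \in X ->
  weight u v = 4 -> weight u x = 3 -> weight v x = 3 -> False.
Proof.
move=> uX vX xX uv ux vx.
have : wdeg X x <= 2 * #|X| + 2 * #|light u v|.
  rewrite /wdeg /light -sum_pred big_distrr /= mulnC -sum_nat_const -big_split /=.
  apply: leq_sum => y yX.
  have := dense_edge4_sum unifE freeE cliqueS dX uX vX yX uv.
  have := triangle433_weight unifE freeE cliqueS (y := y) uv ux vx.
  by have := weight4 x y; lia.
have := card_light uX vX uv; have := dX xX.
by have : 0 < #|X| by [apply/card_gt0P; exists x]; lia.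
Qed.

Definition N4 x := [set y in X | weight x y == 4].

(** A vertex that is not light splits its 6 as 4 + 2 or 2 + 4, as 3 + 3 is excluded by
    [dense_no433]. A degree of at least 2.99 then leaves (2.99 - 2 - 0.02) / 2 = 0.485 for the
    weight-4 neighbours. *)
Lemma card_N4_edge u v : u \in X -> v \in X -> weight u v = 4 ->
  485 * #|X| <= 1000 * #|N4 u|.
Proof.
move=> uX vX uv.
have : wdeg X u <= 2 * #|X| + 2 * #|N4 u| + #|light u v|.
  rewrite /wdeg /light /N4 -!sum_pred big_distrr /= mulnC -sum_nat_const -!big_split /=.
  apply: leq_sum => y yX.
  have := dense_edge4_sum unifE freeE cliqueS dX uX vX yX uv.
  have := dense_no433 uX vX yX uv.
  by have := weight4 u y; lia.
by have := card_light uX vX uv; have := dX uX; lia.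
Qed.

Lemma colour_classes_equal u v x y : weight u v = 3 -> colours u v = colours x y ->
  weight u x = 3 -> weight u y = 3 -> weight v x = 3 -> weight v y = 3 -> False.
Proof.
move=> uv cxy ux uy vx vy; have := quad_sdr unifE freeE cliqueS u v x y.
rewrite /= -cxy setIid -/(weight u v) uv.
have := weight_colI cliqueS u x v y; have := weight_colI cliqueS u y v x.
by rewrite ux uy vx vy; lia.
Qed.

Definition N3 x := [set y in X | weight x y == 3].

Lemma card_N3 x : x \in X -> (forall y, y \in X -> weight x y <= 3) ->
  99 * #|X| <= 100 * #|N3 x|.
Proof.
move=> xX le3.
have : wdeg X x <= 2 * #|X| + #|N3 x|.
  rewrite /wdeg /N3 -!sum_pred mulnC -sum_nat_const -!big_split /=.
  by apply: leq_sum => y /le3; lia.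
by have := dX xX; lia.
Qed.

(** Greedy: each vertex already chosen excludes at most 1% of [X] by [card_N3]. *)
Lemma weight3_clique k : 0 < #|X| -> k <= 10 ->
  (forall x y, x \in X -> y \in X -> weight x y <= 3) ->
  exists s : seq T, [/\ size s = k, {subset s <= X} &
    pairwise (fun x y => weight x y == 3) s].
Proof.
move=> X0 + le3; elim: k => [_|k IHk k10]; first by exists [::].
have [s [ss sX ps]] := IHk (ltnW k10).
have [/existsP[y /andP[yX /allP sy]]|] :=
    boolP [exists y in X, all (fun x => weight y x == 3) s].
  exists (y :: s); split=> /=; first by rewrite ss.
    by move=> z; rewrite inE => /predU1P[->//|/sX].
  by rewrite ps andbT; apply/allP.
rewrite negb_exists => /forallP none.
have : \sum_(y in X) 1 <= \sum_(y in X) \sum_(x <- s) (weight x y != 3).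
  apply: leq_sum => y yX; move: (none y); rewrite yX => /= /allPn[x xs yx].
  by rewrite (big_rem x)//= weightC yx.
rewrite exchange_big /= sum1_card => bad.
have : 100 * \sum_(x <- s) \sum_(y in X) (weight x y != 3) <= \sum_(x <- s) #|X|.
  rewrite big_distrr /= big_seq_cond [leqRHS]big_seq_cond; apply: leq_sum => x.
  rewrite andbT => /sX xX; have := card_N3 xX (fun y => le3 x y xX).
  have : \sum_(y in X) (weight x y != 3) + #|N3 x| = #|X|.
    rewrite /N3 -sum_pred -big_split /= -sum1_card; apply: eq_bigr => y _.
    by case: eqP.
  by lia.
by rewrite big_const_seq count_predT ss iter_addn_0; nia.
Qed.

(** Otherwise ten vertices have pairwise weight 3. They form five disjoint pairs, but only four
    colour sets of size 3 exist, so two pairs share theirs, against [colour_classes_equal]. *)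
Lemma dense_exists4 : 0 < #|X| -> exists u v, [/\ u \in X, v \in X & weight u v = 4].
Proof.
move=> X0.
have [/existsP[u /existsP[v /and3P[uX vX /eqP uv]]]|no4] :=
  boolP [exists u, exists v, [&& u \in X, v \in X & weight u v == 4]].
  by exists u, v.
have le3 x y : x \in X -> y \in X -> weight x y <= 3.
  move=> xX yX; move/existsPn/(_ x)/existsPn/(_ y): no4.
  by rewrite xX yX /=; have := weight4 x y; lia.
have [s [ss sX ps]] := weight3_clique X0 (leqnn 10) le3.
have /card_gt0P[x0 _] := X0.
pose p i := nth x0 s i.
have w3 i j : i < 10 -> j < 10 -> i != j -> weight (p i) (p j) = 3.
  have lt3 a b : a < b -> b < 10 -> weight (p a) (p b) = 3.
    move=> ab b10; apply/eqP; move/(pairwiseP x0): ps; apply => //.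
      by rewrite inE ss (ltn_trans ab).
    by rewrite inE ss.
  move=> i10 j10; rewrite neq_ltn => /orP[ij|ji]; first exact: lt3.
  by rewrite weightC lt3.
pose e (i : 'I_5) := colours (p i.*2) (p i.*2.+1).
have e_inj : injective e.
  move=> i j; have := ltn_ord i; have := ltn_ord j => j5 i5 eij.
  apply/eqP/negPn/negP; rewrite -val_eqE /= => ij.
  by apply: (colour_classes_equal _ eij); apply: w3; lia.
have := subset_leq_card (B := [set A : {set T} | A \subset S & #|A| == 3])
                        (A := [set e i | i : 'I_5]).
rewrite card_imset// card_ord cards_draws cliqueS.1 => H.
suff : 5 <= 'C(4, 3) by [].
apply: H; apply/subsetP => _ /imsetP[i _ ->]; have := ltn_ord i => i5.
rewrite inE {1}/e {1}/colours setIdE subsetIl; apply/eqP.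
by apply: w3; lia.
Qed.

Lemma setI_nonempty (A B : {set T}) : A \subset X -> B \subset X ->
  #|X| < #|A| + #|B| -> exists2 x, x \in A & x \in B.
Proof.
move=> AX BX; rewrite -cardsUI => lt.
have : #|A :|: B| <= #|X| by rewrite subset_leq_card// subUset AX.
move=> le; have /card_gt0P[x] : 0 < #|A :&: B| by lia.
by rewrite inE => /andP[]; exists x.
Qed.

Lemma N4_sub x : N4 x \subset X.
Proof. by rewrite /N4 setIdE subsetIl. Qed.

Lemma N3_sub x : N3 x \subset X.
Proof. by rewrite /N3 setIdE subsetIl. Qed.

(** A vertex [x] without weight-4 neighbours would have weight 3 to 99% of [X], in particular to
    both ends of some pair of weight 4, contradicting [dense_no433]. *)
Lemma card_N4 x : x \in X -> 485 * #|X| <= 1000 * #|N4 x|.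
Proof.
move=> xX; have X0 : 0 < #|X| by apply/card_gt0P; exists x.
have [/existsP[y /andP[yX /eqP xy]]|] := boolP [exists y in X, weight x y == 4].
  exact: card_N4_edge xX yX xy.
rewrite negb_exists => /forallP no4.
have cN3 : 99 * #|X| <= 100 * #|N3 x|.
  apply: card_N3 => // y yX; move: (no4 y); rewrite yX /=.
  by have := weight4 x y; lia.
have [u [v [uX vX uv]]] := dense_exists4 X0.
have := card_N4_edge uX vX uv => cu.
have [y] : exists2 y, y \in N3 x & y \in N4 u.
  by apply: setI_nonempty; rewrite ?N3_sub ?N4_sub//; lia.
rewrite !inE => /andP[yX /eqP xy] /andP[_ /eqP uy].
have cy : 485 * #|X| <= 1000 * #|N4 y|.
  by apply: (card_N4_edge yX uX); rewrite weightC.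
have [z] : exists2 z, z \in N3 x & z \in N4 y.
  by apply: setI_nonempty; rewrite ?N3_sub ?N4_sub//; lia.
rewrite !inE => /andP[zX /eqP xz] /andP[_ /eqP yz].
by case: (dense_no433 yX zX xX yz); rewrite weightC.
Qed.

Lemma N4_disjoint x y : x \in X -> y \in X -> 3 <= weight x y -> N4 x :&: N4 y = set0.
Proof.
move=> xX yX xy; apply/setP => z; rewrite !inE; apply/negP.
move=> /andP[/andP[zX /eqP xz] /andP[_ /eqP yz]].
exact: (no443 xX yX zX xy xz yz).
Qed.

Lemma dense_bipartite : 0 < #|X| -> exists A B,
  [/\ A :|: B = X, [disjoint A & B],
      (forall x y, x \in A -> y \in A -> weight x y <= 2) &
      (forall x y, x \in B -> y \in B -> weight x y <= 2)].
Proof.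
move=> X0; have /card_gt0P[u uX] := X0.
pose A := [set x in X | N4 x :&: N4 u != set0]; exists A, (X :\: A).
have AX : A \subset X by rewrite /A setIdE subsetIl.
(* If [N4 x] and [N4 u] meet at all, say in [y], both avoid [N4 y], so their union has density at
   most 0.515 and their intersection at least 2 * 0.485 - 0.515 = 0.455. *)
have cap x : x \in A -> 455 * #|X| <= 1000 * #|N4 x :&: N4 u|.
  rewrite inE => /andP[xX /set0Pn[y]]; rewrite !inE.
  move=> /andP[/andP[yX /eqP xy] /andP[_ /eqP uy]].
  have Dx := N4_disjoint xX yX; rewrite xy in Dx.
  have Du := N4_disjoint uX yX; rewrite uy in Du.
  have : #|(N4 x :|: N4 u) :|: N4 y| <= #|X|.
    by rewrite subset_leq_card// !subUset !N4_sub.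
  have := cardsUI (N4 x :|: N4 u) (N4 y); rewrite setIUl Dx// Du// setU0 cards0.
  have := cardsUI (N4 x) (N4 u).
  by have := card_N4 xX; have := card_N4 uX; have := card_N4 yX; lia.
split.
- by rewrite -{1}(setIidPr AX) setID.
- by rewrite disjoints_subset; apply/subsetP => x xA; rewrite in_setC in_setD xA.
(* A pair of weight at least 3 would give two disjoint subsets of [N4 u] of density 0.455 each,
   while [N4 u] has density at most 0.515. *)
- move=> x y xA yA; rewrite leqNgt; apply/negP => xy.
  have [xX yX] := (subsetP AX _ xA, subsetP AX _ yA).
  have D := N4_disjoint xX yX xy.
  have := cardsUI (N4 x :&: N4 u) (N4 y :&: N4 u).
  rewrite setIACA D set0I cards0 => c.
  have : #|(N4 x :&: N4 u) :|: (N4 y :&: N4 u)| <= #|N4 u|.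
    by rewrite subset_leq_card// subUset !subsetIr.
  have : #|N4 x :|: N4 y| <= #|X| by rewrite subset_leq_card// subUset !N4_sub.
  have : #|N4 u| <= #|X| by rewrite subset_leq_card// N4_sub.
  have [z] : exists z, z \in N4 u.
    apply/card_gt0P; have := card_N4 uX; lia.
  rewrite inE => /andP[zX /eqP uz].
  have Du := N4_disjoint uX zX; rewrite uz in Du.
  have := cardsUI (N4 u) (N4 z); rewrite Du// cards0.
  have : #|N4 u :|: N4 z| <= #|X| by rewrite subset_leq_card// subUset !N4_sub.
  by have := cap _ xA; have := cap _ yA; have := card_N4 zX; lia.
(* Here [N4 x], [N4 y], [N4 u] would be pairwise disjoint, each of density at least 0.485. *)
- move=> x y; rewrite !inE => /andP[+ xX] /andP[+ yX].
  rewrite xX yX /= !negbK => /eqP xu /eqP yu.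
  rewrite leqNgt; apply/negP => xy; have D := N4_disjoint xX yX xy.
  have := cardsUI (N4 x :|: N4 y) (N4 u); rewrite setIUl xu yu setU0 cards0.
  have := cardsUI (N4 x) (N4 y); rewrite D cards0.
  have : #|(N4 x :|: N4 y) :|: N4 u| <= #|X|.
    by rewrite subset_leq_card// !subUset !N4_sub.
  by have := card_N4 xX; have := card_N4 yX; have := card_N4 uX; lia.
Qed.

End DenseStructure.

(** * Ordered triples *)

Section Triples.
Variables (T : finType) (E : {set {set T}}).
Hypothesis unifE : uniform_hypergraph 3 E.
Local Notation edge3 := (edge3 E).

Definition codeg (X : {set T}) x y : nat := \sum_(z in X) edge3 x y z.
Definition deg2 (X : {set T}) x : nat := \sum_(y in X) codeg X x y.
Definition triples (X : {set T}) : nat := \sum_(x in X) deg2 X x.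

Lemma triplesD1 (X : {set T}) x : x \in X -> triples X = triples (X :\ x) + 3 * deg2 X x.
Proof.
move=> xX; pose X' := X :\ x.
have xxE a : edge3 x a x = false by rewrite edge3CA (edge3xx unifE).
have degE : deg2 X x = \sum_(y in X') \sum_(z in X') edge3 x y z.
  rewrite /deg2 (big_setD1 x xX) /= [codeg X x x]big1; last first.
    by move=> z _; rewrite (edge3xx unifE).
  by apply: eq_bigr => y _; rewrite /codeg (big_setD1 x xX) /= xxE.
have -> : triples X = deg2 X x + (\sum_(a in X') codeg X x a +
    (\sum_(a in X') \sum_(y in X') edge3 x a y + triples X')).
  rewrite {1}/triples (big_setD1 x xX) /= -!big_split /=; congr addn.
  apply: eq_bigr => a _; rewrite {1}/deg2 (big_setD1 x xX) /= /codeg; congr addn.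
    by apply: eq_bigr => z _; rewrite edge3C.
  rewrite -big_split; apply: eq_bigr => y _; rewrite (big_setD1 x xX) /=; congr addn.
  by rewrite edge3CA edge3C.
have -> : \sum_(a in X') codeg X x a = deg2 X x.
  rewrite /deg2 (big_setD1 x xX) /= [codeg X x x]big1 // => z _; by rewrite (edge3xx unifE).
by rewrite -degE /X'; lia.
Qed.

(** Double counting of the links of the vertices of [S]: this is how degrees in the hypergraph
    become weight in the multigraph. *)
Lemma wsum_deg2 (S X : {set T}) : wsum E S X = \sum_(i in S) deg2 X i.
Proof.
rewrite /wsum /wdeg /deg2 /codeg exchange_big [RHS]exchange_big /=; apply: eq_bigr => y _.
rewrite [RHS]exchange_big /=; apply: eq_bigr => z _.
by rewrite weightC /weight /colours sum_pred.
Qed.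

Lemma clique4_of_edges x y z w : edge3 x y z -> edge3 x y w -> edge3 x z w ->
  edge3 y z w -> clique4 E [set x; y; z; w].
Proof.
move=> xyz xyw xzw yzw; split.
  rewrite setUC cardsU1 !inE !negb_or; have -> := eqP (forall_inP unifE _ xyz).
  rewrite !(eq_sym w) ?(edge3_neqr unifE xyw) ?(edge3_neqr unifE yzw).
  by have /and3P[_ -> _] := edge3_neq unifE xzw.
move=> i j k; rewrite !inE -!orbA.
by do 3!case/or4P => /eqP ->; rewrite ?eqxx ?andbF // => _;
  do ?[by [] | by rewrite edge3CA | by rewrite edge3C | by rewrite edge3C edge3CA
      | by rewrite edge3CA edge3C | by rewrite edge3C edge3CA edge3C].
Qed.

(* Extend a pair x, y of maximal codegree: for an average common neighbour z,
   the codegrees of xy, xz and yz exceed 2 #|X|. *)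
Lemma exists_clique4 (X : {set T}) : 0 < #|X| ->
  (forall x, x \in X -> 74 * #|X| ^ 2 <= 100 * deg2 X x) ->
  exists2 S : {set T}, S \subset X & clique4 E S.
Proof.
move=> X0 degX; have /card_gt0P[x0 x0X] := X0.
have x0P : ((x0, x0).1 \in X) && ((x0, x0).2 \in X) by rewrite x0X.
case: (arg_maxnP (P := fun p => (p.1 \in X) && (p.2 \in X))
  (fun p => codeg X p.1 p.2) x0P) => -[x y] /= /andP[xX yX] maxD.
have {}maxD a b : a \in X -> b \in X -> codeg X a b <= codeg X x y.
  by move=> aX bX; have /= := maxD (a, b); rewrite aX bX => /(_ isT).
pose N a b := [set z in X | edge3 a b z].
have cN a b : codeg X a b = #|N a b| by rewrite /N -sum_pred.
have NX a b : N a b \subset X by rewrite /N setIdE subsetIl.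
pose D := codeg X x y; pose k := #|X :\: N x y|.
have mE : #|X| = D + k.
  by rewrite /D cN /k -(cardsID (N x y) X) (setIidPr (NX _ _)).
have sumN a : a \in X -> deg2 X a <= \sum_(z in N x y) codeg X a z + D * k.
  move=> aX; rewrite /deg2 (big_setID (N x y)) /= (setIidPr (NX _ _)) leq_add2l.
  by apply: sum_le_const => z; rewrite inE => /andP[_ zX]; apply: maxD.
have [/existsP[z /andP[zN Dz]]|none] :=
    boolP [exists z in N x y, 2 * #|X| < D + codeg X x z + codeg X y z].
  have : 0 < #|N x y :&: N x z :&: N y z|.
    have := cardsUI (N x y) (N x z); have := cardsUI (N x y :&: N x z) (N y z).
    have : #|N x y :|: N x z| <= #|X| by rewrite subset_leq_card// subUset !NX.
    have : #|(N x y :&: N x z) :|: N y z| <= #|X|.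
      by rewrite subset_leq_card// subUset NX subIset// NX.
    by move: Dz; rewrite /D !cN; lia.
  move=> /card_gt0P[w]; rewrite !inE => /andP[/andP[/andP[wX xyw] /andP[_ xzw]] /andP[_ yzw]].
  move: zN; rewrite inE => /andP[zX xyz].
  exists [set x; y; z; w]; last exact: clique4_of_edges.
  by rewrite !subUset !sub1set xX yX zX.
(* If no [z] works, the degrees of [x] and [y] add up to at most [D ^ 2 + 4 * D * k]. With
   [D + k = #|X|] this is at most 4/3 of [#|X| ^ 2], below the assumed 1.48. *)
have : \sum_(z in N x y) codeg X x z + \sum_(z in N x y) codeg X y z <= (D + 2 * k) * D.
  have -> : (D + 2 * k) * D = (D + 2 * k) * #|N x y| by rewrite {2}/D cN.
  rewrite -big_split; apply: sum_le_const => z zN.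
  by move/existsPn/(_ z): none; rewrite zN /= mE; lia.
have := sumN x xX; have := sumN y yX; have := degX x xX; have := degX y yX.
by move: X0; rewrite mE; nia.
Qed.

Lemma sum_orderings (e X : {set T}) : #|e| = 3 -> e \subset X ->
  \sum_(x in X) \sum_(y in X) \sum_(z in X) ([set x; y; z] == e : nat) = 6.
Proof.
move=> e3 eX.
have sub (P : pred T) (A : {set T}) : A \subset e ->
    \sum_(x in X) ((x \in A) && P x : nat) = #|[set x in A | P x]|.
  move=> Ae; rewrite sum_pred; apply: eq_card => x; rewrite !inE andbA.
  case: (boolP (x \in A)); rewrite ?andbF // => xA.
  by rewrite (subsetP eX)// (subsetP Ae).
have eq3 x y z : ([set x; y; z] == e) = [&& x \in e, y \in e :\ x & z \in e :\ x :\ y].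
  apply/eqP/and3P => [exyz|[xe]].
    split; rewrite -exyz ?inE ?eqxx ?orbT ?andbT //.
    - apply/eqP => yx; move: e3; rewrite -exyz yx setUid cards2; by case: eqP.
    - apply/andP; split; apply/eqP => zx; move: e3; rewrite -exyz zx.
        by rewrite -setUA setUid cards2; case: eqP.
      by rewrite setUAC setUid cards2; case: eqP.
  rewrite !inE => /andP[yx ye] /and3P[zy zx ze].
  apply/eqP; rewrite eqEcard !subUset !sub1set xe ye ze /= e3.
  rewrite setUC cardsU1 !inE negb_or zx zy cards2 eq_sym yx //.
transitivity (\sum_(x in X) \sum_(y in X) ((x \in e) && (y \in e :\ x) : nat)).
  apply: eq_bigr => x _; apply: eq_bigr => y _.
  under eq_bigr do rewrite eq3.
  have [/andP[xe yex]|] := boolP ((x \in e) && (y \in e :\ x)); last first.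
    by move=> n; apply: big1 => z _; rewrite andbA (negPf n).
  rewrite xe yex /=.
  under eq_bigr => z _ do rewrite -[z \in _]andbT.
  rewrite (sub xpredT); last by rewrite !subDset !subsetU ?subxx ?orbT.
  have := cardsD1 x e; have := cardsD1 y (e :\ x); rewrite xe yex e3 => c1 c2.
  by rewrite setIdE setIT; lia.
transitivity (\sum_(x in X) 2 * (x \in e)).
  apply: eq_bigr => x _; have [xe|xe] := boolP (x \in e); last first.
    by rewrite big1.
  under eq_bigr => z _ do rewrite /= -[z \in _]andbT.
  rewrite (sub xpredT); last by rewrite subD1set.
  by have := cardsD1 x e; rewrite xe e3 setIdE setIT; lia.
rewrite -big_distrr /=; under eq_bigr => z _ do rewrite -[z \in _]andbT.
by rewrite (sub xpredT) // setIdE setIT e3.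
Qed.

Lemma triples_edges (X : {set T}) : triples X = 6 * edges_inside E X.
Proof.
rewrite /edges_inside -sum1_card big_distrr /=.
transitivity (\sum_(e in [set e in E | e \subset X])
    \sum_(x in X) \sum_(y in X) \sum_(z in X) ([set x; y; z] == e : nat)); last first.
  apply: eq_bigr => e; rewrite inE => /andP[eE eX].
  by rewrite sum_orderings // (eqP (forall_inP unifE _ eE)).
rewrite exchange_big; apply: eq_bigr => x xX /=.
rewrite exchange_big; apply: eq_bigr => y yX /=.
rewrite exchange_big; apply: eq_bigr => z zX /=.
rewrite sum_pred.
have [xyz|xyz] := boolP (edge3 x y z).
  rewrite (_ : [set _ | _] = [set [set x; y; z]]) ?cards1 //; last first.
  apply/setP => e; rewrite !inE [RHS]eq_sym; case: eqP => [<-|]; rewrite ?andbF // andbT.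
  by rewrite -/(edge3 x y z) xyz !subUset !sub1set xX yX.
apply: esym; apply: eq_card0 => e; rewrite !inE; apply/negP => /andP[/andP[eE _] /eqP exyz].
by move: xyz; rewrite /edge3 exyz eE.
Qed.

Hypothesis freeE : fano_free E.

(** A minimal counterexample has large minimum degree, hence a clique on four vertices by
    [exists_clique4]. Its four links weigh at least [3 * #|X| ^ 2 + 4 * #|X|] together, more than
    [wsum_le] allows. *)
Lemma triples_le (X : {set T}) : 4 * triples X <= 3 * #|X| ^ 3 + 16 * #|X| ^ 2.
Proof.
have [m] := ubnP #|X|; elim: m X => // m IHm X Xm; rewrite leqNgt; apply/negP => big.
have [X0|X0] := posnP #|X|.
  by move: big; rewrite /triples (cards0_eq X0) big_set0 muln0.
have deg x : x \in X -> 3 * #|X| ^ 2 + 4 * #|X| <= 4 * deg2 X x.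
  move=> xX; have cX := cardsD1 x X; rewrite xX in cX.
  have /IHm : #|X :\ x| < m by lia.
  by move: big; rewrite (triplesD1 xX) cX; nia.
have [S SX cS] : exists2 S : {set T}, S \subset X & clique4 E S.
  by apply: exists_clique4 => // x /deg; nia.
have := wsum_le unifE freeE cS X; rewrite wsum_deg2.
have : \sum_(i in S) (3 * #|X| ^ 2 + 4 * #|X|) <= \sum_(i in S) 4 * deg2 X i.
  by apply: leq_sum => i iS; apply/deg/(subsetP SX).
by rewrite sum_nat_const cS.1 -big_distrr /=; nia.
Qed.

End Triples.

(** * The bipartite lower bound *)

Definition bipartite_edges (T : finType) (A : {set T}) : {set {set T}} :=
  [set e : {set T} | [&& #|e| == 3, ~~ (e \subset A) & ~~ (e \subset ~: A)]].

Lemma bipartite_uniform (T : finType) (A : {set T}) :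
  uniform_hypergraph 3 (bipartite_edges A).
Proof. by apply/forall_inP => e; rewrite inE => /and3P[]. Qed.

(** The Fano plane is not 2-colourable: each of the 128 colourings of its points leaves a line
    monochromatic. *)
Lemma bipartite_fano_free (T : finType) (A : {set T}) : fano_free (bipartite_edges A).
Proof.
apply/negP => /existsP[f /andP[_ /forall_inP fE]].
have line (i : 'I_7) : ~~ [&& f i \in A, f (i + 1)%R \in A & f (i + 3%:R)%R \in A] &&
    ~~ [&& f i \notin A, f (i + 1)%R \notin A & f (i + 3%:R)%R \notin A].
  have := fE (fano_line i) (imset_f _ isT); rewrite inE => /and3P[_].
  by rewrite /fano_line !imsetU !imset_set1 !subUset !sub1set !inE -!andbA => -> ->.
have el (m : nat) (lt : m < 7) : Ordinal lt = inord m by apply: val_inj; rewrite /= inordK.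
pose b (m : nat) := f (inord m) \in A.
have {}line (m p q : nat) : m < 7 -> p = (m + 1) %% 7 -> q = (m + 3) %% 7 ->
    ~~ [&& b m, b p & b q] && ~~ [&& ~~ b m, ~~ b p & ~~ b q].
  move=> m7 -> ->; have := line (inord m); rewrite /b.
  have -> : (inord m + 1)%R = inord ((m + 1) %% 7) :> 'I_7.
    by apply: val_inj; rewrite /= !inordK ?ltn_pmod.
  have -> : (inord m + 3%:R)%R = inord ((m + 3) %% 7) :> 'I_7.
    by apply: val_inj; rewrite /= !inordK ?ltn_pmod.
  by [].
move: (line 0 1 3 isT erefl erefl) (line 1 2 4 isT erefl erefl).
move: (line 2 3 5 isT erefl erefl) (line 3 4 6 isT erefl erefl).
move: (line 4 5 0 isT erefl erefl) (line 5 6 1 isT erefl erefl).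
move: (line 6 0 2 isT erefl erefl).
by case: (b 0); case: (b 1); case: (b 2); case: (b 3); case: (b 4); case: (b 5); case: (b 6).
Qed.

Lemma edges_insideT (T : finType) (E : {set {set T}}) : edges_inside E [set: T] = #|E|.
Proof. by apply: eq_card => e; rewrite inE subsetT andbT. Qed.

Lemma sum_indicator3 (T : finType) (A : {set T}) :
  \sum_(x : T) \sum_(y : T) \sum_(z : T) (x \in A) * ((y \in A) * (z \in A)) = #|A| ^ 3.
Proof.
have s : \sum_(z : T) (z \in A) = #|A| by rewrite -sum1_card [RHS]big_mkcond.
under eq_bigr do under eq_bigr do rewrite -!big_distrr /= s.
under eq_bigr do rewrite -big_distrr -big_distrl /= s.
by rewrite -big_distrl /= s; nia.
Qed.

Lemma sum_const_set (T : finType) c : \sum_(x : T) c = #|T| * c.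
Proof. by rewrite big_const iter_addn_0 mulnC. Qed.

Lemma sum_setT (T : finType) (F : T -> nat) :
  \sum_(x in [set: T]) F x = \sum_(x : T) F x.
Proof. by apply: eq_bigl => x; rewrite inE. Qed.

Lemma sum_eq1 (T : finType) (a : T) : \sum_(x : T) (x == a : nat) = 1.
Proof. by rewrite (bigD1 a) //= eqxx big1 // => x /negPf ->. Qed.

(** Balanced bipartition. Of the error [15 * n ^ 2], the part [12 * n ^ 2] pays for triples with a
    repeated entry, and the rest covers the imbalance for odd [n]. *)
Lemma ex_fano_ge n : 3 * n ^ 3 <= 24 * ex_fano n + 15 * n ^ 2.
Proof.
pose A := [set i : 'I_n | i < n./2]; pose E := bipartite_edges A.
have : #|E| <= ex_fano n.
  by apply: (leq_bigmax_cond (F := fun E : {set {set 'I_n}} => #|E|));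
    rewrite bipartite_uniform bipartite_fano_free.
have := triples_edges (bipartite_uniform A) [set: 'I_n]; rewrite edges_insideT -/E.
have cA : #|A| = n./2.
  rewrite -sum1_card (eq_bigl (fun i : 'I_n => i < n./2)); last by move=> i; rewrite inE.
  by rewrite -(big_ord_widen n (fun _ => 1)) ?sum1_card ?card_ord //; lia.
have cB : #|~: A| = n - n./2 by rewrite cardsCs setCK card_ord cA.
have : \sum_(x : 'I_n) \sum_(y : 'I_n) \sum_(z : 'I_n) 1 <=
    triples E [set: 'I_n] + #|A| ^ 3 + #|~: A| ^ 3 + 3 * n ^ 2.
  have -> : 3 * n ^ 2 = \sum_(x : 'I_n) \sum_(y : 'I_n) \sum_(z : 'I_n) (z == x) +
     \sum_(x : 'I_n) \sum_(y : 'I_n) \sum_(z : 'I_n) (z == y) +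
     \sum_(x : 'I_n) \sum_(y : 'I_n) \sum_(z : 'I_n) (y == x).
    under eq_bigr do under eq_bigr do rewrite sum_eq1.
    under [X in _ + X + _]eq_bigr do under eq_bigr do rewrite sum_eq1.
    under [X in _ + X]eq_bigr do rewrite exchange_big.
    under [X in _ + X]eq_bigr do under eq_bigr do rewrite sum_eq1.
    by rewrite !sum_const_set card_ord; lia.
  rewrite -!sum_indicator3 /triples /deg2 /codeg.
  rewrite sum_setT -!big_split; apply: leq_sum => x _ /=.
  rewrite sum_setT -!big_split; apply: leq_sum => y _ /=.
  rewrite sum_setT -!big_split; apply: leq_sum => z _ /=.
  rewrite !inE.
  case: (eqVneq z x) => [|zx]; first lia.
  case: (eqVneq z y) => [|zy]; first lia.
  case: (eqVneq y x) => [|yx]; first lia.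
  rewrite /edge3 inE !subUset !sub1set !inE.
  rewrite setUC cardsU1 !inE negb_or zx zy cards2 (eq_sym x) yx /=.
  by case: (x < _); case: (y < _); case: (z < _).
by rewrite !sum_const_set card_ord cA cB; nia.
Qed.

(** * Octahedra *)

Lemma sum_sqr_le (I : finType) (F : I -> nat) :
  (\sum_i F i) ^ 2 <= #|I| * \sum_i F i ^ 2.
Proof.
rewrite -(leq_pmul2l (isT : 0 < 2)) -mulnn big_distrl big_distrr /=.
have -> : 2 * (#|I| * \sum_i F i ^ 2) = \sum_(i : I) \sum_(j : I) (F i ^ 2 + F j ^ 2).
  under [RHS]eq_bigr do rewrite big_split /= sum_const_set.
  by rewrite big_split /= -big_distrr sum_const_set /=; lia.
apply: leq_sum => i _; rewrite big_distrr big_distrr /=; apply: leq_sum => j _.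
exact: nat_Cauchy.
Qed.

(** Cauchy-Schwarz in the form that duplicates the index [j]. *)
Lemma sum2_sqr_le (I J : finType) (F : I -> J -> nat) :
  (\sum_i \sum_j F i j) ^ 2 <= #|I| * \sum_(p : J * J) \sum_i F i p.1 * F i p.2.
Proof.
apply: leq_trans (sum_sqr_le _) _; rewrite leq_mul2l; apply/orP; right.
rewrite exchange_big /=; apply: leq_sum => i _.
rewrite -(pair_bigA _ (fun j j' => F i j * F i j')) /= -mulnn big_distrl /=.
by apply: leq_sum => j _; rewrite big_distrr.
Qed.

(** Each of the three coordinates is duplicated in turn by [sum2_sqr_le]. The three steps cost
    factors [#|T| ^ 2], [#|T| ^ 3], [#|T| ^ 4], which are then raised to the powers 4, 2, 1; hence
    18 = 8 + 6 + 4. *)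
Lemma octahedron_count (T : finType) (f : T -> T -> T -> nat) :
  (\sum_x \sum_y \sum_z f x y z) ^ 8 <= #|T| ^ 18 *
    \sum_(r : T * T) \sum_(q : T * T) \sum_(p : T * T)
      (f p.1 q.1 r.1 * f p.2 q.1 r.1 * (f p.1 q.2 r.1 * f p.2 q.2 r.1)) *
      (f p.1 q.1 r.2 * f p.2 q.1 r.2 * (f p.1 q.2 r.2 * f p.2 q.2 r.2)).
Proof.
pose g (p : T * T) y z := f p.1 y z * f p.2 y z.
pose h (p q : T * T) z := g p q.1 z * g p q.2 z.
have s1 : (\sum_x \sum_y \sum_z f x y z) ^ 2 <=
    #|T| ^ 2 * \sum_(p : T * T) \sum_y \sum_z g p y z.
  have := sum2_sqr_le (fun (u : T * T) x => f x u.1 u.2).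
  rewrite card_prod mulnn exchange_big /=.
  under eq_bigr do rewrite -(pair_bigA _ (fun y z => f _ y z)).
  move=> /leq_trans; apply; rewrite leq_mul2l; apply/orP; right.
  by apply: leq_sum => p _; rewrite -(pair_bigA _ (fun y z => g p y z)).
have s2 : (\sum_(p : T * T) \sum_y \sum_z g p y z) ^ 2 <=
    #|T| ^ 3 * \sum_(q : T * T) \sum_(p : T * T) \sum_z h p q z.
  have := sum2_sqr_le (fun (u : (T * T) * T) y => g u.1 y u.2).
  rewrite !card_prod mulnn -expnSr -(pair_bigA _ (fun p z => \sum_y g p y z)) /=.
  under eq_bigr do rewrite exchange_big.
  move=> /leq_trans; apply; rewrite leq_mul2l; apply/orP; right.
  by apply: leq_sum => q _; rewrite -(pair_bigA _ (fun p z => h p q z)).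
have s3 : (\sum_(q : T * T) \sum_(p : T * T) \sum_z h p q z) ^ 2 <=
    #|T| ^ 4 * \sum_(r : T * T) \sum_(q : T * T) \sum_(p : T * T) h p q r.1 * h p q r.2.
  have := sum2_sqr_le (fun (u : (T * T) * (T * T)) z => h u.2 u.1 z).
  rewrite !card_prod !mulnn -expnM -(pair_bigA _ (fun q p => \sum_z h p q z)) /=.
  move=> /leq_trans; apply; rewrite leq_mul2l; apply/orP; right.
  by apply: leq_sum => r _; rewrite -(pair_bigA _ (fun q p => h p q r.1 * h p q r.2)).
set S1 := \sum_x _ in s1 *; set S2 := \sum_p _ in s1 s2; set S3 := \sum_q _ in s2 s3.
have a1 : S1 ^ 8 <= #|T| ^ 8 * S2 ^ 4.
  by rewrite (expnM _ 2 4) (expnM _ 2 4) -expnMn leq_exp2r.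
have a2 : S2 ^ 4 <= #|T| ^ 6 * S3 ^ 2.
  by rewrite (expnM _ 2 2) (expnM _ 3 2) -expnMn leq_exp2r.
apply: leq_trans a1 _; rewrite -[18]/(8 + (6 + 4)) expnD -mulnA leq_mul2l.
apply/orP; right; apply: leq_trans a2 _; rewrite expnD -mulnA leq_mul2l.
by apply/orP; right.
Qed.

(** For uniform [E] the diagonal pairs count as well, so degenerate octahedra are charged in the
    same way as the others. *)
Definition nonlinks (T : finType) (E : {set {set T}}) (c : T) (A : {set T}) : nat :=
  \sum_(x in A) \sum_(y in A) ~~ edge3 E c x y.

(* An octahedron inside A whose three diagonals all lie in the link of c would
   complete a Fano plane with c. *)
Lemma triples_octahedron (T : finType) (E : {set {set T}}) (A : {set T}) (c : T) :
  uniform_hypergraph 3 E -> fano_free E ->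
  triples E A ^ 8 <= 3 * #|T| ^ 22 * nonlinks E c A.
Proof.
move=> unifE freeE.
pose f x y z : nat := [&& x \in A, y \in A, z \in A & edge3 E x y z].
pose bad (p : T * T) : nat := [&& p.1 \in A, p.2 \in A & ~~ edge3 E c p.1 p.2].
have -> : triples E A = \sum_x \sum_y \sum_z f x y z.
  rewrite /triples /deg2 /codeg big_mkcond; apply: eq_bigr => x _.
  case xA : (x \in A); last by rewrite big1 // => y _; rewrite big1 // => z _; rewrite /f xA.
  rewrite big_mkcond; apply: eq_bigr => y _.
  case yA : (y \in A); last by rewrite big1 // => z _; rewrite /f yA andbF.
  rewrite big_mkcond; apply: eq_bigr => z _; rewrite /f xA yA.
  by case: (z \in A).
have nonlinksE : nonlinks E c A = \sum_p bad p.
  rewrite -(pair_bigA _ (fun x y => bad (x, y))) /nonlinks big_mkcond; apply: eq_bigr => x _.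
  case xA : (x \in A); last by rewrite big1 // => y _; rewrite /bad /= xA.
  rewrite big_mkcond; apply: eq_bigr => y _; rewrite /bad /= xA.
  by case: (y \in A).
apply: leq_trans (octahedron_count f) _.
have -> : 3 * #|T| ^ 22 * nonlinks E c A = #|T| ^ 18 * (#|T| ^ 4 * (3 * nonlinks E c A)).
  rewrite (expnD _ 18 4); move: (#|T| ^ 18) (#|T| ^ 4) (nonlinks E c A).
  by move=> a b d; rewrite -!mulnA mulnCA; congr (_ * _); rewrite mulnCA.
rewrite leq_mul2l; apply/orP; right.
(* Every octahedron must have a diagonal outside the link of [c]; it is charged to that diagonal,
   and the other two diagonals have [#|T| ^ 4] choices. *)
have -> : #|T| ^ 4 * (3 * nonlinks E c A) =
    \sum_(r : T * T) \sum_(q : T * T) \sum_(p : T * T) (bad p + bad q + bad r).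
  under [RHS]eq_bigr do under eq_bigr do rewrite !big_split /= -nonlinksE !sum_const_set.
  under [RHS]eq_bigr do rewrite !big_split /= -!big_distrr /= -nonlinksE !sum_const_set.
  by rewrite !big_split /= -!big_distrr /= -nonlinksE !sum_const_set !card_prod; ring.
apply: leq_sum => -[z z'] _; apply: leq_sum => -[y y'] _; apply: leq_sum => -[x x'] _ /=.
rewrite /f /bad /=.
case xA : (x \in A); last by rewrite !mul0n.
case x'A : (x' \in A); last by rewrite !(mul0n, muln0).
case yA : (y \in A); last by rewrite !mul0n.
case y'A : (y' \in A); last by rewrite !(mul0n, muln0).
case zA : (z \in A); last by rewrite !mul0n.
case z'A : (z' \in A); last by rewrite !(mul0n, muln0).
rewrite /=.
have [cx|] := boolP (edge3 E c x x'); last by do ![case: (edge3 _ _ _ _)].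
have [cy|] := boolP (edge3 E c y y'); last by do ![case: (edge3 _ _ _ _)].
have [cz|] := boolP (edge3 E c z z'); last by do ![case: (edge3 _ _ _ _)].
have [e1|] := boolP (edge3 E x y z); last by rewrite !mul0n.
have [e2|] := boolP (edge3 E x y' z'); last by rewrite !(mul0n, muln0).
have [e3|] := boolP (edge3 E x' y z'); last by rewrite !(mul0n, muln0).
have [e4|] := boolP (edge3 E x' y' z); last by rewrite !(mul0n, muln0).
(* The lines are the three diagonals extended by [c] and four pairwise non-adjacent faces of the
   octahedron. *)
exfalso; apply: (@fano_config _ _ unifE freeE c x y x' z z' y') => //.
- by rewrite edge3C.
- by rewrite edge3CA.
- by rewrite edge3CA edge3C.
- by rewrite edge3C edge3CA edge3C.
- by rewrite edge3C edge3CA.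
Qed.

(** * A vertex whose link contains nearly all pairs of a part *)

Lemma exists_le_average (T : finType) (A : {set T}) (F : T -> nat) : 0 < #|A| ->
  exists2 t, t \in A & #|A| * F t <= \sum_(x in A) F x.
Proof.
move=> /card_gt0P[t0 t0A]; case: (arg_minnP F t0A) => t tA tmin.
by exists t => //; rewrite -sum_nat_const; apply: leq_sum => x /tmin.
Qed.

Section CommonColour.
Variables (T : finType) (E : {set {set T}}) (S : {set T}).
Hypotheses (unifE : uniform_hypergraph 3 E) (freeE : fano_free E).
Hypothesis cliqueS : clique4 E S.
Local Notation weight := (weight E S).
Local Notation colours := (colours E S).

(** Averaging gives [t] in [B], then [u] and [x0] in [A], of small total deficit towards [A]; any
    [c] among the colours of [u] and [x0] works. Two applications of [inner_triangle_colours] carry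
    [c] from [u x0] to [u x] and on to [x y], unless one of the weights involved is deficient. *)
Lemma common_colour (A B : {set T}) (z D : nat) : 0 < z ->
  #|A| <= z -> 2 * z <= 5 * #|A| -> 2 * z <= 5 * #|B| -> 1000 * D <= z ^ 2 ->
  \sum_(x in A) \sum_(y in A) (2 - weight x y) <= D ->
  2 * \sum_(t in B) \sum_(x in A) (4 - weight t x) <= D ->
  exists c, nonlinks E c A <= 15 * D.
Proof.
move=> z0 Az zA zB Dz defA defAB.
pose dt t := \sum_(x in A) (4 - weight t x).
pose du u := \sum_(x in A) (2 - weight u x).
have [|t tB avt] := @exists_le_average _ B dt; first by lia.
have cdt : 4 * (z * dt t) <= 5 * D.
  by have := leq_mul zB (leqnn (dt t)); have : 2 * \sum_(t in B) dt t <= D := defAB; lia.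
rewrite -mulnn in Dz.
have lt : 800 * dt t <= z by rewrite -(leq_pmul2l z0); lia.
pose A1 := [set x in A | 4 <= weight t x].
have cA1 : #|A| <= #|A1| + dt t.
  rewrite /A1 -sum_pred /dt -big_split /= -sum1_card; apply: leq_sum => x _; lia.
have avg_du (A' : {set T}) : A' \subset A -> 38 * z <= 100 * #|A'| ->
    exists2 u, u \in A' & 38 * (z * du u) <= 100 * D.
  move=> A'A cA'; have [|u uA' avu] := @exists_le_average _ A' du; first by lia.
  have : \sum_(u in A') du u <= D.
    apply: leq_trans defA; rewrite [leqRHS](big_setID A') /= (setIidPr A'A).
    by rewrite leq_addr.
  by exists u => //; have := leq_mul cA' (leqnn (du u)); lia.
have A1A : A1 \subset A by rewrite /A1 setIdE subsetIl.
have [|u uA1 cdu] := avg_du A1 A1A; first by lia.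
have lu : 380 * du u <= z by rewrite -(leq_pmul2l z0); lia.
pose A2 := [set x in A1 | 2 <= weight u x].
have cA2 : #|A| <= #|A2| + dt t + du u.
  have -> : #|A2| = \sum_(x in A) ((4 <= weight t x) && (2 <= weight u x)).
    by rewrite sum_pred; apply: eq_card => x; rewrite !inE andbA.
  by rewrite /dt -!big_split /= -sum1_card; apply: leq_sum => x _; lia.
have A2A1 : A2 \subset A1 by rewrite /A2 setIdE subsetIl.
have [|x0 x0A2 cdx0] := avg_du A2 (subset_trans A2A1 A1A); first by lia.
pose q := dt t + du u + du x0.
have zq : z * q <= 7 * D by rewrite /q; lia.
move: x0A2; rewrite !inE => /andP[/andP[x0A tx0] ux0].
move: uA1; rewrite !inE => /andP[uA tu].
have eq4 x : 4 <= weight t x -> weight t x = 4.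
  by have := weight_le4 cliqueS t x; lia.
have /card_gt0P[c cP] : 0 < #|colours u x0| by apply: leq_trans ux0.
exists c.
(* The deficiency sits at [x], at [y] or on the pair itself. By [zq] the three terms are at most
   [7 * D], [7 * D] and [D], which gives 15. *)
have : nonlinks E c A <= #|A| * q + #|A| * q + \sum_(x in A) \sum_(y in A) (2 - weight x y).
  have qE : q = \sum_(x in A) (4 - weight t x + (2 - weight u x) + (2 - weight x0 x)).
    by rewrite !big_split.
  have -> : #|A| * q + #|A| * q =
      \sum_(x in A) \sum_(y in A) (4 - weight t x + (2 - weight u x) + (2 - weight x0 x)) +
      \sum_(x in A) \sum_(y in A) (4 - weight t y + (2 - weight u y) + (2 - weight x0 y)).
    under eq_bigr do rewrite sum_nat_const.
    by rewrite -big_distrr /= -qE sum_nat_const.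
  rewrite -!big_split; apply: leq_sum => x xA; rewrite -!big_split; apply: leq_sum => y yA /=.
  have [//|nc] := boolP (edge3 E c x y).
  rewrite lt0n !addn_eq0 !subn_eq0 -!andbA; apply/negP.
  move=> /and5P[tx ux x0x ty /and3P[uy _ xy]].
  have itc := inner_triangle_colours unifE freeE cliqueS.
  have e1 := itc _ _ _ _ (eq4 _ tx0) (eq4 _ tu) (eq4 _ tx).
  have e2 := itc _ _ _ _ (eq4 _ tu) (eq4 _ tx) (eq4 _ ty) ux uy xy.
  rewrite weightC in e1; have {}e1 := e1 ux0 x0x ux.
  case/negP: nc; move: cP; rewrite coloursC e1 e2.
  by rewrite inE => /andP[].
by have : #|A| * q <= z * q; [rewrite leq_mul2r Az orbT | lia].
Qed.

End CommonColour.

Lemma colour_bipartition (T : finType) (E : {set {set T}}) (S Z : {set T}) (D : nat) :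
  uniform_hypergraph 3 E -> fano_free E -> clique4 E S -> dense E S Z ->
  0 < #|Z| -> 3 * #|Z| ^ 2 <= wsum E S Z + D -> 1000 * D <= #|Z| ^ 2 ->
  exists A B c c', [/\ A :|: B = Z, [disjoint A & B],
    nonlinks E c A <= 15 * D & nonlinks E c' B <= 15 * D].
Proof.
move=> unifE freeE cS dZ Z0 wZ DZ.
have [A [B [AB disjAB wA wB]]] := dense_bipartite unifE freeE cS dZ Z0.
have w4 := weight_le4 cS; pose w := weight E S.
have cZ : #|Z| = #|A| + #|B| by rewrite -AB cardsU (disjoint_setI0 disjAB) cards0 subn0.
have sumU F : \sum_(x in Z) F x = \sum_(x in A) F x + \sum_(x in B) F x.
  by rewrite -bigU //=; apply: eq_bigl => x; rewrite -AB !inE.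
have comp (X Y : {set T}) (k : nat) : (forall x y, x \in X -> y \in Y -> w x y <= k) ->
    \sum_(x in X) \sum_(y in Y) (k - w x y) + \sum_(x in X) \sum_(y in Y) w x y =
    #|X| * (#|Y| * k).
  move=> wk; rewrite -big_split -sum_nat_const; apply: eq_bigr => x xX /=.
  rewrite -big_split -sum_nat_const; apply: eq_bigr => y yY /=.
  by rewrite subnK // wk.
have cA := comp A A 2 wA; have cB := comp B B 2 wB.
have cAB := comp A B 4 (fun x y _ _ => w4 x y).
have symAB F : (forall x y, F x y = F y x) ->
    \sum_(x in B) \sum_(y in A) F x y = \sum_(x in A) \sum_(y in B) F x y :> nat.
  by move=> Fs; rewrite exchange_big; apply: eq_bigr => x _; apply: eq_bigr.
have wE : wsum E S Z = \sum_(x in A) \sum_(y in A) w x y + \sum_(x in B) \sum_(y in B) w x y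
    + 2 * \sum_(x in A) \sum_(y in B) w x y.
  rewrite /wsum /wdeg sumU.
  under eq_bigr do rewrite sumU; under [X in _ + X]eq_bigr do rewrite sumU.
  rewrite !big_split /= (symAB w); first by rewrite /w; lia.
  exact: weightC.
(* With sizes a and b, the ideal weight 2a^2 + 2b^2 + 8ab falls short of 3(a + b)^2 by exactly (a -
   b)^2. As subtraction is truncated, the sum of the two differences stands for |a - b|. *)
have defs : \sum_(x in A) \sum_(y in A) (2 - w x y) + \sum_(x in B) \sum_(y in B) (2 - w x y)
    + 2 * \sum_(x in A) \sum_(y in B) (4 - w x y) +
    (#|A| - #|B| + (#|B| - #|A|)) ^ 2 <= D.
  move: wZ cA cB cAB; rewrite cZ wE.
  move: (\sum_(x in A) \sum_(y in A) w x y) (\sum_(x in B) \sum_(y in B) w x y).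
  move: (\sum_(x in A) \sum_(y in B) w x y) => wAB wAA wBB.
  move: (\sum_(x in A) \sum_(y in A) (2 - w x y)) (\sum_(x in B) \sum_(y in B) (2 - w x y)).
  move: (\sum_(x in A) \sum_(y in B) (4 - w x y)).
  move: #|A| #|B| => a b dAB dA dB; rewrite -!mulnn => wZ cA cB cAB.
  case: (leqP a b) => [|/ltnW] /subnKC; [move: (b - a) | move: (a - b)] => k.
    by move=> bE; rewrite -bE subnDA subnn sub0n in wZ cB cAB *; lia.
  by move=> aE; rewrite -aE subnDA subnn sub0n in wZ cA cAB *; lia.
have balanced : 2 * #|Z| <= 5 * #|A| /\ 2 * #|Z| <= 5 * #|B|.
  have : 1000 * (#|A| - #|B| + (#|B| - #|A|)) ^ 2 <= (#|A| + #|B|) ^ 2 by rewrite -cZ; lia.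
  by rewrite cZ; split; nia.
have [zA zB] := balanced.
have [leA leB] : #|A| <= #|Z| /\ #|B| <= #|Z| by rewrite cZ; lia.
have [c cA'] : exists c, nonlinks E c A <= 15 * D.
  apply: (common_colour unifE freeE cS Z0 leA zA zB DZ); move: defs.
    by clear; rewrite /w; lia.
  by rewrite -(symAB (fun x y => 4 - w x y)) => [|x y];
    [clear; rewrite /w; lia|rewrite /w weightC].
have [c' cB'] : exists c, nonlinks E c B <= 15 * D.
  apply: (common_colour unifE freeE cS Z0 leB zB zA DZ); move: defs.
    by clear; rewrite /w; lia.
  by clear; rewrite /w; lia.
by exists A, B, c, c'.
Qed.

Lemma triples_subset (T : finType) (E : {set {set T}}) (A X : {set T}) :
  uniform_hypergraph 3 E -> A \subset X ->
  triples E X <= triples E A + 3 * (#|X :\: A| * #|T| ^ 2).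
Proof.
move=> unifE; have [m] := ubnP #|X|; elim: m X => // m IHm X Xm AX.
have [/eqP|/card_gt0P[x]] := posnP #|X :\: A|.
  by rewrite cards_eq0 setD_eq0 => XA; rewrite (_ : X = A) ?leq_addr //;
    apply/eqP; rewrite eqEsubset XA.
move=> xXA; have := xXA; rewrite inE => /andP[xA xX].
have cX := cardsD1 x X; rewrite xX in cX.
have cXA := cardsD1 x (X :\: A); rewrite xXA in cXA.
have XAx : (X :\ x) :\: A = (X :\: A) :\ x by rewrite setDDl setUC -setDDl.
have := IHm (X :\ x); rewrite XAx (triplesD1 unifE xX) => IH.
have {}IH : triples E (X :\ x) <= triples E A + 3 * (#|X :\: A :\ x| * #|T| ^ 2).
  apply: IH; first by lia.
  by rewrite subsetD1 AX.
have : deg2 E X x <= #|T| ^ 2.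
  have XT : #|X| <= #|T| := max_card _.
  apply: (@leq_trans (#|T| * #|X|)); last by rewrite -mulnn leq_mul2l XT orbT.
  apply: sum_le_const => y _; apply: leq_trans XT; rewrite -sum1_card.
  by apply: leq_sum => z _; case: edge3.
by rewrite cXA; lia.
Qed.

(** * Near-extremal hypergraphs *)

Local Open Scope ring_scope.

(** For [F] a count minus a multiple of a power of the size, the last property is a minimum degree
    condition and the comparison with [F X] bounds the size from below. *)
Lemma exists_maximal_subset (R : realType) (T : finType) (X : {set T}) (F : {set T} -> R) :
  exists Y : {set T}, [/\ Y \subset X, F X <= F Y & forall y, y \in Y -> F (Y :\ y) <= F Y].
Proof.
case: (@arg_maxP _ R _ X (fun Y => Y \subset X) F (subxx X)) => Y YX maxY.
exists Y; split=> //; first exact: maxY.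
by move=> y yY; apply: maxY; rewrite (subset_trans (subD1set _ _)).
Qed.

Lemma natrB1 (R : realType) (m m' : nat) : m = (1 + m')%N -> m'%:R = m%:R - 1 :> R.
Proof. by move=> ->; rewrite natrD addrC addKr. Qed.

Section Extremal.
Variables (R : realType) (T : finType) (E : {set {set T}}) (s : R).
Hypotheses (unifE : uniform_hypergraph 3 E) (freeE : fano_free E).
Hypotheses (s_gt0 : 0 < s) (s_small : s <= 1 / 5 / 1000).
Hypothesis large : 15 <= s ^+ 2 * #|T|%:R.

Lemma large_sn : 3000 <= s * #|T|%:R.
Proof.
have sn0 : 0 <= s * #|T|%:R by rewrite mulr_ge0 // ltW.
have : s * (s * #|T|%:R) <= 1 / 5 / 1000 * (s * #|T|%:R) by rewrite ler_wpM2r.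
by move: large; rewrite mulrA -expr2; lra.
Qed.

Lemma large_n : 3000 <= #|T|%:R :> R.
Proof.
apply: le_trans large_sn _; have n0 : 0 <= #|T|%:R :> R by [].
by rewrite -[leRHS]mul1r ler_wpM2r //; move: s_small; lra.
Qed.

Lemma dense_triples_subset :
  (3 / 4 - s ^+ 2) * #|T|%:R ^+ 3 <= (triples E [set: T])%:R ->
  exists Y : {set T}, (1 - 2 * s) * #|T|%:R <= #|Y|%:R :> R /\
    forall y, y \in Y -> (3 / 4 - s) * (#|Y|%:R ^+ 2 - #|Y|%:R) <= (deg2 E Y y)%:R.
Proof.
move=> many; have [Y [_ FY maxY]] := exists_maximal_subset [set: T]
  (fun X => (triples E X)%:R - (3 / 4 - s) * #|X|%:R ^+ 3 : R).
have n_large := large_n; have [s0 s1] := (s_gt0, s_small).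
have le_mn : #|Y|%:R <= #|T|%:R :> R by rewrite ler_nat max_card.
have m0 : 0 <= #|Y|%:R :> R by [].
exists Y; split.
  have : 4 * (triples E Y)%:R <= 3 * #|Y|%:R ^+ 3 + 16 * #|Y|%:R ^+ 2 :> R.
    by rewrite -!natrX -!natrM -natrD ler_nat triples_le.
  move: FY many le_mn m0 n_large large; rewrite cardsT.
  move: (triples E Y)%:R (triples E setT)%:R #|Y|%:R #|T|%:R => tY tT m n.
  move=> FY many mn m0 n0 n_s le_tY.
  have m2 : m ^+ 2 <= n ^+ 2 by rewrite lerXn2r // nnegrE; lra.
  have n3 : 15 * n ^+ 2 <= s ^+ 2 * n ^+ 3.
    have -> : s ^+ 2 * n ^+ 3 = s ^+ 2 * n * n ^+ 2 by ring.
    by rewrite ler_wpM2r // exprn_ge0 //; lra.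
  (* The functional is at least (s - s^2)n^3 on the whole vertex set and, by [triples_le], at most
     sm^3 + 4m^2 on [Y]; the term 4m^2 is absorbed by s^2 n^3. *)
  have key : s * ((1 - 2 * s) * n ^+ 3) <= s * m ^+ 3.
    by have := sqr_ge0 n; lra.
  rewrite ler_pM2l // in key.
  have m3 : m ^+ 3 <= m * n ^+ 2 by rewrite exprS ler_wpM2l.
  rewrite -(ler_pM2r (_ : 0 < n ^+ 2)); last by rewrite exprn_gt0; lra.
  by rewrite -mulrA -exprS; lra.
move=> y yY; have := maxY y yY; rewrite (triplesD1 unifE yY).
have c := cardsD1 y Y; rewrite yY /= in c; rewrite (natrB1 R c) natrD natrM.
by move: (triples E (Y :\ y))%:R (deg2 E Y y)%:R => t d; nra.
Qed.

Lemma dense_clique4 (Y : {set T}) : (1 - 2 * s) * #|T|%:R <= #|Y|%:R :> R ->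
  (forall y, y \in Y -> (3 / 4 - s) * (#|Y|%:R ^+ 2 - #|Y|%:R) <= (deg2 E Y y)%:R) ->
  exists2 S, clique4 E S & (3 - 5 * s) * #|Y|%:R ^+ 2 <= (wsum E S Y)%:R.
Proof.
move=> mn degY; have n_large := large_n; have sn_large := large_sn.
have [s0 s1] := (s_gt0, s_small).
have m_large : 1000 <= #|Y|%:R :> R by nra.
have sm_large : 3 <= s * #|Y|%:R by nra.
have [||S SY cS] := @exists_clique4 _ _ unifE Y.
- by rewrite -(ltr_nat R); lra.
- move=> x /degY; rewrite -(ler_nat R) (natrM _ 74) (natrM _ 100) natrX.
  move: (deg2 E Y x)%:R #|Y|%:R m_large => d m m_large deg.
  have : 1000 * m <= m ^+ 2 by rewrite expr2 ler_wpM2r //; lra.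
  have : 0 <= (1 / 5 / 1000 - s) * (m ^+ 2 - m) by apply: mulr_ge0; nra.
  by lra.
exists S => //; rewrite wsum_deg2 natr_sum.
have : \sum_(i in S) (3 / 4 - s) * (#|Y|%:R ^+ 2 - #|Y|%:R) <= \sum_(i in S) (deg2 E Y i)%:R.
  by apply: ler_sum => i /(subsetP SY)/degY.
rewrite sumr_const cS.1; apply: le_trans; rewrite -mulr_natl.
by move: #|Y|%:R m_large sm_large => m m_large sm_large; nra.
Qed.

(** The threshold 3 - 1/200 lies between the 2.99 of [dense] and [3 - 5 * s]. The first gap absorbs
    rounding in the degrees; the second makes [Z] large and lets it inherit the weight bound from
    [Y]. *)
Lemma dense_multigraph_subset (S Y : {set T}) : clique4 E S ->
  1 / 2 * #|T|%:R <= #|Y|%:R :> R ->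
  (3 - 5 * s) * #|Y|%:R ^+ 2 <= (wsum E S Y)%:R ->
  exists Z : {set T}, [/\ (1 - 1200 * s) * #|Y|%:R <= #|Z|%:R :> R, dense E S Z &
    (3 - 5 * s) * #|Z|%:R ^+ 2 <= (wsum E S Z)%:R].
Proof.
move=> cS mn wY; have [Z [ZY FZ maxZ]] := exists_maximal_subset Y
  (fun X => (wsum E S X)%:R - (3 - 1 / 200) * #|X|%:R ^+ 2 : R).
have n_large := large_n; have sn_large := large_sn; have [s0 s1] := (s_gt0, s_small).
have m_large : 1000 <= #|Y|%:R :> R by lra.
have sm_large : 3 <= s * #|Y|%:R by nra.
have zm : #|Z|%:R <= #|Y|%:R :> R by rewrite ler_nat subset_leq_card.
have z0 : 0 <= #|Z|%:R :> R by [].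
have z_large : (1 - 1200 * s) * #|Y|%:R <= #|Z|%:R.
  have : (wsum E S Z)%:R <= 3 * #|Z|%:R ^+ 2 + 3 * #|Z|%:R :> R.
    by rewrite -!natrX -!natrM -natrD ler_nat wsum_le.
  move: FZ wY zm z0 m_large sm_large.
  move: (wsum E S Y)%:R (wsum E S Z)%:R #|Y|%:R #|Z|%:R => wy wz m z.
  move=> FZ wY zm z0 m_large sm_large wz_le.
  have m2 : 3 * m <= s * m ^+ 2 by rewrite expr2 mulrA ler_wpM2r //; lra.
  have z2 : z ^+ 2 <= z * m by rewrite expr2 ler_wpM2l.
  rewrite -(ler_pM2r (_ : 0 < m)); last by lra.
  by rewrite -mulrA -expr2; lra.
have z_big : 400 <= #|Z|%:R :> R by nra.
exists Z; split=> //.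
  move=> x xZ; have := maxZ x xZ; rewrite (wsumD1 S unifE xZ).
  have c := cardsD1 x Z; rewrite xZ /= in c; rewrite (natrB1 R c) natrD natrM.
  rewrite -(ler_nat R) !natrM.
  move: (wsum E S (Z :\ x))%:R (wdeg E S Z x)%:R #|Z|%:R z_big => w d z z_big.
  by lra.
have : #|Z|%:R ^+ 2 <= #|Y|%:R ^+ 2 :> R by rewrite lerXn2r ?nnegrE.
by move: FZ wY; nra.
Qed.

End Extremal.

(** * Counting hyperedges inside the parts and assembling the partition *)

Lemma triples_bound (R : realType) (T : finType) (E : {set {set T}}) (A : {set T})
    (c : T) (D : nat) (r : R) :
  uniform_hypergraph 3 E -> fano_free E -> 0 < r -> r ^+ 8 <= 1 / 36 ->
  D%:R <= 5 * r ^+ 32 * #|T|%:R ^+ 2 -> (nonlinks E c A <= 15 * D)%N ->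
  (triples E A)%:R <= r * #|T|%:R ^+ 3.
Proof.
move=> unifE freeE r0 r8 DT nA.
have n0 : 0 <= #|T|%:R :> R by [].
have rn0 : 0 <= r * #|T|%:R ^+ 3 by rewrite mulr_ge0 ?exprn_ge0 // ltW.
rewrite -(ler_pXn2r (_ : 0 < 8)%N) ?nnegrE //.
have : (triples E A ^ 8 <= 45 * (#|T| ^ 22 * D))%N.
  apply: leq_trans (triples_octahedron A c unifE freeE) _.
  apply: (@leq_trans (3 * #|T| ^ 22 * (15 * D))); first by rewrite leq_mul2l nA orbT.
  by move: (#|T| ^ 22)%N => N; lia.
rewrite -(ler_nat R) natrX (natrM _ 45) natrM natrX => /le_trans; apply.
apply: (@le_trans _ _ (45 * (#|T|%:R ^+ 22 * (5 * r ^+ 32 * #|T|%:R ^+ 2)))).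
  by rewrite ler_wpM2l // ler_wpM2l // exprn_ge0.
have -> : 45 * (#|T|%:R ^+ 22 * (5 * r ^+ 32 * #|T|%:R ^+ 2)) =
  225 * r ^+ 8 ^+ 3 * (r ^+ 8 * #|T|%:R ^+ 24) by ring.
(* Of r^32, the factor r^24 <= 36^(-3) is spent on the constant 225 = 45 * 5, and r^8 gives the
   claimed bound. *)
have -> : (r * #|T|%:R ^+ 3) ^+ 8 = r ^+ 8 * #|T|%:R ^+ 24 by ring.
rewrite -[leRHS]mul1r ler_wpM2r //.
  by rewrite mulr_ge0 // exprn_ge0 // ltW.
have : r ^+ 8 ^+ 3 <= (1 / 36) ^+ 3 by rewrite lerXn2r // nnegrE ?exprn_ge0 ?(ltW r0) //; lra.
by lra.
Qed.

Lemma partition_of_many_triples (R : realType) (T : finType) (E : {set {set T}}) (r : R) :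
  uniform_hypergraph 3 E -> fano_free E -> 0 < r -> r ^+ 8 <= 1 / 36 ->
  15 <= r ^+ 64 * #|T|%:R ->
  (3 / 4 - r ^+ 64) * #|T|%:R ^+ 3 <= (triples E [set: T])%:R ->
  exists A B : {set T}, [/\ A :|: B = [set: T], [disjoint A & B] &
    (edges_inside E A + edges_inside E B)%:R <= 1 / 2 * r * #|T|%:R ^+ 3].
Proof.
move=> unifE freeE r0 r8; have rE : r ^+ 64 = r ^+ 32 ^+ 2 by rewrite -exprM.
rewrite rE => large many.
have s0 : 0 < r ^+ 32 by rewrite exprn_gt0.
have sr : r ^+ 32 <= r / 36 / 36 / 36.
  have -> : r ^+ 32 = r * (r ^+ 8 ^+ 3 * r ^+ 7) by ring.
  rewrite -!mulrA ler_pM2l //.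
  have r1 : r <= 1.
    by rewrite leNgt; apply/negP => /ltW/(exprn_ege1 8); lra.
  have : r ^+ 8 ^+ 3 <= (1 / 36) ^+ 3 by rewrite lerXn2r // nnegrE ?exprn_ge0 ?(ltW r0) //; lra.
  have : r ^+ 8 ^+ 3 * r ^+ 7 <= r ^+ 8 ^+ 3.
    by rewrite ler_piMr ?exprn_ge0 ?exprn_ile1 ?(ltW r0).
  by lra.
have r1 : r <= 1.
  by rewrite leNgt; apply/negP => /ltW/(exprn_ege1 8); lra.
have s1 : r ^+ 32 <= 1 / 5 / 1000 by lra.
have [Y [mn degY]] := dense_triples_subset unifE freeE s0 s1 large many.
have n0 : 0 <= #|T|%:R :> R by [].
have [S cS wY] := dense_clique4 unifE s0 s1 large mn degY.
have mn2 : 1 / 2 * #|T|%:R <= #|Y|%:R :> R.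
  apply: le_trans mn; rewrite ler_wpM2r //; lra.
have [Z [zm dZ wZ]] := dense_multigraph_subset unifE freeE s0 s1 large cS mn2 wY.
have zT : #|Z|%:R <= #|T|%:R :> R by rewrite ler_nat max_card.
pose D := (3 * #|Z| ^ 2 - wsum E S Z)%N.
have DZ : D%:R <= 5 * r ^+ 32 * #|Z|%:R ^+ 2.
  rewrite /D; case: (leqP (wsum E S Z) (3 * #|Z| ^ 2)) => [le|/ltnW lt].
    by rewrite natrB // natrM natrX; lra.
  by rewrite (eqP lt) mulr_ge0 ?exprn_ge0 // mulr_ge0 // ltW.
have z2 : 0 <= #|Z|%:R ^+ 2 :> R by rewrite exprn_ge0.
have D1000 : (1000 * D <= #|Z| ^ 2)%N.
  rewrite -(ler_nat R) (natrM _ 1000) natrX.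
  have : r ^+ 32 * #|Z|%:R ^+ 2 <= 1 / 5 / 1000 * #|Z|%:R ^+ 2 by rewrite ler_wpM2r.
  by lra.
have zn : (1 - 1202 * r ^+ 32) * #|T|%:R <= #|Z|%:R.
  apply: le_trans zm.
  apply: (@le_trans _ _ ((1 - 1200 * r ^+ 32) * ((1 - 2 * r ^+ 32) * #|T|%:R))).
    rewrite mulrA ler_wpM2r //; have := sqr_ge0 (r ^+ 32); lra.
  by rewrite ler_wpM2l //; lra.
have Z0 : (0 < #|Z|)%N.
  rewrite -(ltr_nat R); apply: lt_le_trans zn; rewrite mulr_gt0 //; first by lra.
  rewrite lt_def n0 andbT; apply/negP => /eqP T0; move: large; rewrite T0; lra.
have wZD : (3 * #|Z| ^ 2 <= wsum E S Z + D)%N by rewrite -leq_subLR.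
have [A [B [c [c' [AB disjAB cA cB]]]]] := colour_bipartition unifE freeE cS dZ Z0 wZD D1000.
have DT : D%:R <= 5 * r ^+ 32 * #|T|%:R ^+ 2.
  apply: le_trans DZ _; rewrite ler_wpM2l ?lerXn2r ?nnegrE // mulr_ge0 // ltW //.
have tA := triples_bound unifE freeE r0 r8 DT cA.
have tB := triples_bound unifE freeE r0 r8 DT cB.
(* The few vertices outside [Z] join [A]; [triples_subset] bounds the triples that they add. *)
exists (~: B), B; split.
- by rewrite setUC setUCr.
- by rewrite disjoint_sym disjoints_subset setCK.
have AsubB : A \subset ~: B by rewrite -disjoints_subset.
have := triples_subset unifE AsubB.
have -> : ~: B :\: A = ~: Z by rewrite -AB setCU setDE setIC.
rewrite (triples_edges unifE) -(ler_nat R) natrM natrD (natrM _ 3) natrM natrX cardsCs setCK.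
rewrite natrB ?max_card // natrD => le.
have eB : 6 * (edges_inside E B)%:R <= r * #|T|%:R ^+ 3.
  by apply: le_trans tB; rewrite (triples_edges unifE) natrM.
have junk : (#|T|%:R - #|Z|%:R) * #|T|%:R ^+ 2 <= 1202 * r ^+ 32 * #|T|%:R ^+ 3.
  rewrite (exprS _ 2) mulrA ler_wpM2r ?exprn_ge0 //; lra.
have s3 : r ^+ 32 * #|T|%:R ^+ 3 <= r / 36 / 36 / 36 * #|T|%:R ^+ 3.
  by rewrite ler_wpM2r // exprn_ge0.
have r3 : 0 <= r * #|T|%:R ^+ 3 by rewrite mulr_ge0 ?exprn_ge0 // ltW.
(* In units of r n^3, the two parts have at most 1 + 3 * 1202 / 36^3 and 1 ordered triples. A sixth
   of the total is below 1/2. *)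
by clear -le eB junk s3 r3 tA; lra.
Qed.

Theorem theorem1p2 (R : realType) (delta : R)
    (hdelta : 0 < delta < (1 / 36) ^+ 8) :
  exists n0 : nat, forall n : nat, (n0 <= n)%N ->
  forall (T : finType) (E : {set {set T}}),
    #|T| = n ->
    uniform_hypergraph 3 E ->
    fano_free E ->
    (ex_fano n)%:R - delta * n%:R ^+ 3 / 8 <= #|E|%:R ->
    exists A B : {set T},
      [/\ A :|: B = [set: T],
          [disjoint A & B] &
          (edges_inside E A + edges_inside E B)%:R
            <= 9 / 16 * (3 ^+ 2 * 2 ^+ 4 * 139) `^ (1 / 8)
                 * delta `^ (1 / 64) * n%:R ^+ 3
            < 194 / 100 * delta `^ (1 / 64) * n%:R ^+ 3].
Proof.
have /andP[d0 d1] := hdelta.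
set r := delta `^ (1 / 64); set K := _ `^ (1 / 8).
have r0 : 0 < r by rewrite powR_gt0.
have r64 : r ^+ 64 = delta.
  rewrite -powR_mulrn ?(ltW r0) // /r -powRrM (_ : 1 / 64 * 64%:R = 1); last by field.
  by rewrite powRr1 ?(ltW d0).
have r8 : r ^+ 8 <= 1 / 36.
  rewrite -(ler_pXn2r (_ : 0 < 8)%N) ?nnegrE ?exprn_ge0 ?(ltW r0) //; last by lra.
  by rewrite -exprM r64 ltW.
have K0 : 0 < K by rewrite powR_gt0 ?mulr_gt0 ?exprn_gt0.
have K8 : K ^+ 8 = 3 ^+ 2 * 2 ^+ 4 * 139.
  rewrite -powR_mulrn ?(ltW K0) // /K -powRrM (_ : 1 / 8 * 8%:R = 1); last by field.
  by rewrite powRr1 ?mulr_ge0 ?exprn_ge0.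
(* This suffices for the first bound, since 1/2 <= 9/16; the strict one needs K < 776/225, because
   9/16 * 776/225 = 1.94. *)
have K1 : 1 <= K.
  rewrite leNgt; apply/negP => K1.
  have : K ^+ 8 <= 1 by rewrite exprn_ile1 // ltW.
  by rewrite K8; lra.
have K2 : K < 776 / 225.
  rewrite -(ltr_pXn2r (_ : 0 < 8)%N) ?nnegrE ?(ltW K0) //; last by lra.
  by rewrite K8; lra.
have b0 : 0 <= 15 / delta by rewrite divr_ge0 // ltW.
exists (Num.bound (15 / delta)).+1 => n ltn T E cT unifE freeE many.
have large : 15 <= delta * n%:R.
  have := archi_boundP b0; rewrite ltr_pdivrMr // mulrC => /ltW/le_trans; apply.
  by rewrite ler_pM2l // ler_nat ltnW.
have n0 : 0 < n%:R :> R by rewrite ltr0n; case: n ltn {cT many large}.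
have [||A [B [AB disjAB eAB]]] := partition_of_many_triples unifE freeE r0 r8.
- by rewrite r64 cT.
- rewrite r64 cT (triples_edges unifE) edges_insideT natrM.
  (* The hypothesis on [#|E|] costs 3/4 of delta n^3 ordered triples, and the error 15/4 n^2 of
     [ex_fano_ge] at most the remaining quarter, by [large]. *)
  have : 3 * n%:R ^+ 3 <= 24 * (ex_fano n)%:R + 15 * n%:R ^+ 2 :> R.
    by rewrite -!natrX -!natrM -natrD ler_nat ex_fano_ge.
  have : 15 * n%:R ^+ 2 <= delta * n%:R ^+ 3.
    by rewrite (exprS _ 2) mulrA ler_wpM2r // exprn_ge0 // ltW.
  by move: many; clear; lra.
exists A, B; split=> //.
have rn : 0 < r * n%:R ^+ 3 by rewrite mulr_gt0 // exprn_gt0.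
rewrite cT in eAB; rewrite -!(mulrA _ r) in eAB *; apply/andP; split.
  by apply: le_trans eAB _; rewrite ler_wpM2r ?(ltW rn) //; lra.
by rewrite ltr_pM2r //; lra.
Qed.
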